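(* Let $x \in \mathbb{C}\setminus(\mathbb{R}^-\cup\{1\})$ and let $\nu<0$ be real. Let $K\in\mathscr{H}_0$ and put $$K_1(z)=\frac{1-x}{\nu(1-\nu)x}\int_0^z\frac{K(\zeta)}{\zeta}\,\mathrm{d}\zeta,\qquad z\in\mathbb{C},$$ so that $K_1\in\mathscr{H}_0$. For $E^*\in\mathscr{H}_0$, the equation $\mathfrak{M}E^*=K_1$ (with $\mathfrak{M}$ defined in the context) can be equivalently recast as the singular Volterra integral equation $$\int_0^{\left(\frac{\widehat{\tau}}{x}\right)z}\left[\Psi_-\left(z,\frac{x\xi}{z}\right)-\Psi_+\left(z,\frac{x\xi}{z}\right)\right]E^*(\xi)\,\mathrm{d}\xi=\frac{z}{x}\cdot K_1(z),\qquad z\in\mathbb{C}\setminus\{0\},$$ where the integral is along the straight segment and $$\Psi_\pm(z,\tau)=\frac{e^{-\frac{z}{x}\theta_\pm(\tau)^{-\nu}(1-(1-x)\theta_\pm(\tau))}}{\theta_\pm(\tau)^{-\nu}\left(-\nu+(\nu-1)\theta_\pm(\tau)\right)},\qquad 0<\tau<\widehat{\tau},$$ with $\theta_\pm$, $\widehat\tau$ defined in the context; here ''singular'' means that, for fixed $z$, the kernel satisfies $\Psi_-(z,\tau)-\Psi_+(z,\tau)=O\big((\widehat\tau-\tau)^{-1/2}\big)$ as $\tau\uparrow\widehat\tau$.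
   Context: $\mathbb{R}^-=\,]-\infty,0]$. $\mathscr{H}_0$ is the linear space of entire functions on $\mathbb{C}$ vanishing at $0$. The operator $\mathfrak{M}$ is defined for $f\in\mathscr{H}_0$ by $$\mathfrak{M}f(z)=\int_0^1 e^{-\frac{z}{x}t^{-\nu}(1-(1-x)t)}\,f\left(\frac{z}{x}\,t^{-\nu}(1-t)\right)\frac{\mathrm{d}t}{t},\qquad z\in\mathbb{C}.$$ The function $\tau(t)=t^{-\nu}(1-t)$ on $[0,1]$ has a unique maximum at $\widehat{t}=\nu/(\nu-1)$, with value $\widehat\tau=\tau(\widehat t)$. Let $\tau_-$ and $\tau_+$ be the restrictions of $\tau$ to $[0,\widehat t]$ and $[\widehat t,1]$ respectively; both are monotone bijections onto $[0,\widehat\tau]$, and $\theta_-=\tau_-^{-1}:[0,\widehat\tau]\to[0,\widehat t]$, $\theta_+=\tau_+^{-1}:[0,\widehat\tau]\to[\widehat t,1]$ denote their inverses. *)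

(* Defs.v *)
From Stdlib Require Import Reals.
From Coquelicot Require Import Coquelicot.

Open Scope R_scope.

Definition Cexp (z : C) : C :=
  (exp (Re z) * cos (Im z), exp (Re z) * sin (Im z)).

(* The space H_0: entire means complex differentiable at every point. *)
Definition H0 (f : C -> C) : Prop :=
  (forall z : C, ex_derive (K := C_AbsRing) (V := C_NormedModule) f z) /\
  f (RtoC 0) = RtoC 0.

(* Integral along the straight segment [a, b], improper at both end points, so
   that the value of g at a and b is irrelevant. *)
Definition seg_fun (g : C -> C) (a b : C) (s : R) : C :=
  (g (a + RtoC s * (b - a)) * (b - a))%C.

Definition ex_seg_int (g : C -> C) (a b : C) : Prop :=
  ex_RInt_gen (V := C_R_NormedModule) (seg_fun g a b) (at_right 0) (at_left 1).

Definition seg_int (g : C -> C) (a b : C) : C :=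
  RInt_gen (V := C_R_CompleteNormedModule) (seg_fun g a b)
    (at_right 0) (at_left 1).

(* t ^ a for t >= 0 and a > 0; Rpower alone has Rpower 0 a = 1. *)
Definition rpow (t a : R) : R := if Rlt_dec 0 t then Rpower t a else 0.

Definition M_fun (x : C) (nu : R) (f : C -> C) (z : C) (t : R) : C :=
  (Cexp (- (z / x) * RtoC (rpow t (- nu)) * (1 - (1 - x) * RtoC t)) *
   f (z / x * RtoC (rpow t (- nu)) * RtoC (1 - t)) / RtoC t)%C.

(* The integrand is singular at t = 0 when -1 < nu. *)
Definition ex_Mop (x : C) (nu : R) (f : C -> C) (z : C) : Prop :=
  ex_RInt_gen (V := C_R_NormedModule) (M_fun x nu f z) (at_right 0) (at_left 1).

Definition Mop (x : C) (nu : R) (f : C -> C) (z : C) : C :=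
  RInt_gen (V := C_R_CompleteNormedModule) (M_fun x nu f z)
    (at_right 0) (at_left 1).

Definition tauf (nu t : R) : R := rpow t (- nu) * (1 - t).

Definition that (nu : R) : R := nu / (nu - 1).

Definition tauhat (nu : R) : R := tauf nu (that nu).

(* Inverses of tauf on [0, that] and [that, 1], by definite description; they
   are meant for 0 <= tau <= tauhat. *)
Definition theta_minus (nu tau : R) : R :=
  iota (fun t : R => 0 <= t <= that nu /\ tauf nu t = tau).

Definition theta_plus (nu tau : R) : R :=
  iota (fun t : R => that nu <= t <= 1 /\ tauf nu t = tau).

(* Psi_- and Psi_+ are the cases theta = theta_minus and theta = theta_plus. *)
Definition Psi (theta : R -> R -> R) (x : C) (nu : R) (z : C) (tau : R) : C :=
  let th := theta nu tau in
  (Cexp (- (z / x) * RtoC (rpow th (- nu)) * (1 - (1 - x) * RtoC th)) /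
   RtoC (rpow th (- nu) * (- nu + (nu - 1) * th)))%C.

Definition Psi_minus := Psi theta_minus.
Definition Psi_plus := Psi theta_plus.

(* On the segment [0, (tauhat / x) z] the number x xi / z is real, so Re only
   casts it to R. *)
Definition volterra_fun (x : C) (nu : R) (E : C -> C) (z xi : C) : C :=
  ((Psi_minus x nu z (Re (x * xi / z)) - Psi_plus x nu z (Re (x * xi / z)))
   * E xi)%C.

(* Main.v *)
(** Substituting [tau = tauf nu t] on either side of its maximum at [that nu]
    turns [dt / t] into [dtau / (t tauf' t)] and [t tauf' t] is the denominator
    of [Psi], so the Volterra integral equals [(z / x) Mop x nu E z]; the second
    branch contributes with the opposite sign because [tauf] decreases there.
    The integrals are improper: between inner end points [p < q] the two pieces
    of the [t]-integral differ from the integral from [theta_minus p] to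
    [theta_plus p] by the one from [theta_minus q] to [theta_plus q], a small
    interval around [that nu].  The square root singularity of the kernel is the quadratic
    behaviour of [tauf] at its maximum.  That [K1] is entire means that the
    integral of the continuous function [K(u) / u] from 0 is a primitive of it,
    which is Goursat's theorem for triangles with a vertex at 0. *)

Require Import Defs.
From Stdlib Require Import Reals Lra List.
From Coquelicot Require Import Coquelicot.

Open Scope R_scope.

(** Everything rests on writing a function of H_0 as [f z = z * g z], with [g] continuous everywhere
    and differentiable off 0. Whether [g] is differentiable at 0 is the removable singularity
    theorem, which itself presupposes Cauchy's theory; therefore Goursat's theorem is applied only
    to triangles in discs that omit 0, and the corner at 0 is shrunk by continuity alone. The same
    factorisation makes the integral of [Mop] converge: the argument of [f] is O(t^(-nu)), so the
    integrand is O(t^(-nu-1)), integrable because -nu > 0. Convergence of the Volterra integral does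
    not go through the square root estimate. It is inherited from the t-integral by the change of
    variables, the two branches being kept together. The Volterra equation says nothing at z = 0;
    there both [Mop x nu E] and [K1] vanish. *)

Local Notation CRInt := (@RInt C_R_CompleteNormedModule).
Local Notation CexRInt := (@ex_RInt C_R_NormedModule).
Local Notation CisRInt := (@is_RInt C_R_NormedModule).
Local Notation is_RInt01 f l :=
  (@is_RInt_gen C_R_NormedModule f (at_right 0) (at_left 1) l).

(** * Continuity and differentiability of complex functions *)

Lemma Cminus_diag (z : C) : (z - z)%C = RtoC 0.
Proof. ring. Qed.

Lemma Cmod_minus_sym (a b : C) : Cmod (a - b) = Cmod (b - a).
Proof. rewrite <- Cmod_opp; f_equal; ring. Qed.

Lemma Cmod_minus_le (a b c : C) : Cmod (a - c) <= Cmod (a - b) + Cmod (b - c).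
Proof.
replace (a - c)%C with ((a - b) + (b - c))%C by ring.
apply Cmod_triangle.
Qed.

(** Balls of the product uniform structure on C are squares, so passing to discs of [Cmod] costs a
    factor [sqrt 2] in one direction. *)
Lemma filterlim_C_iff {T : Type} (F : (T -> Prop) -> Prop) {FF : Filter F}
    (f : T -> C) (l : C) :
  filterlim f F (locally (T := C_UniformSpace) l) <->
  forall eps : R, 0 < eps -> F (fun y => Cmod (f y - l) < eps).
Proof.
split.
- intros H eps Heps.
  assert (Hs : 0 < sqrt 2) by (apply sqrt_lt_R0; lra).
  assert (He : 0 < eps / sqrt 2) by (apply Rdiv_lt_0_compat; lra).
  apply filter_imp with (2 := proj1 (filterlim_locally f l) H (mkposreal _ He)).
  intros y Hy.
  apply C_NormedModule_mixin_compat2 in Hy; simpl in Hy.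
  replace eps with (sqrt 2 * (eps / sqrt 2)) by (field; lra).
  exact Hy.
- intros H; apply filterlim_locally; intros eps.
  apply filter_imp with (2 := H eps (cond_pos eps)).
  intros y Hy; apply C_NormedModule_mixin_compat1; exact Hy.
Qed.

Lemma continuous_C_iff {U : UniformSpace} (f : U -> C) (x : U) :
  continuous f x <->
  forall eps : R, 0 < eps -> locally x (fun y => Cmod (f y - f x) < eps).
Proof. apply filterlim_C_iff; apply locally_filter. Qed.

Lemma continuous_CC_iff (f : C -> C) (x : C) :
  continuous f x <->
  forall eps : R, 0 < eps -> exists d : R, 0 < d /\
    forall y, Cmod (y - x) < d -> Cmod (f y - f x) < eps.
Proof.
rewrite continuous_C_iff; split.
- intros H eps Heps; destruct (H eps Heps) as [d Hd].
  exists d; split; [apply cond_pos|].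
  intros y Hy; apply Hd, C_NormedModule_mixin_compat1; exact Hy.
- intros H eps Heps; destruct (H eps Heps) as [d [Hd H']].
  apply locally_C; exists (mkposreal d Hd); intros y Hy; apply H'; exact Hy.
Qed.

Lemma continuous_RC_iff (f : R -> C) (x : R) :
  continuous f x <->
  forall eps : R, 0 < eps -> exists d : R, 0 < d /\
    forall y, Rabs (y - x) < d -> Cmod (f y - f x) < eps.
Proof.
rewrite continuous_C_iff; split.
- intros H eps Heps; destruct (H eps Heps) as [d Hd].
  exists d; split; [apply cond_pos|].
  intros y Hy; apply Hd; exact Hy.
- intros H eps Heps; destruct (H eps Heps) as [d [Hd H']].
  exists (mkposreal d Hd); intros y Hy; apply H'; exact Hy.
Qed.

(** [continuous_mult] lives in the uniform structure of [C_AbsRing], a different term from the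
    product structure on C; by [locally_C] the two have the same neighbourhoods. *)
Lemma continuous_Cmult {U : UniformSpace} (f g : U -> C) (x : U) :
  continuous f x -> continuous g x -> continuous (fun y => f y * g y)%C x.
Proof.
assert (E : forall h : U -> C, continuous h x <->
  continuous (U := AbsRing_UniformSpace C_AbsRing) h x).
{ intros h; split; intros H P HP; apply H; apply locally_C; exact HP. }
intros Hf Hg; apply E.
apply (continuous_mult (K := C_AbsRing) f g); apply E; assumption.
Qed.

Lemma continuous_Cplus {U : UniformSpace} (f g : U -> C) (x : U) :
  continuous f x -> continuous g x -> continuous (fun y => f y + g y)%C x.
Proof. exact (continuous_plus (V := C_NormedModule) f g x). Qed.

Lemma continuous_Cminus {U : UniformSpace} (f g : U -> C) (x : U) :
  continuous f x -> continuous g x -> continuous (fun y => f y - g y)%C x.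
Proof. exact (continuous_minus (V := C_NormedModule) f g x). Qed.

Lemma continuous_Cpair {U : UniformSpace} (f g : U -> R) (x : U) :
  continuous f x -> continuous g x ->
  continuous (fun y => (f y, g y) : C) x.
Proof.
intros Hf Hg; apply continuous_C_iff; intros eps Heps.
assert (Hs : 0 < sqrt 2) by (apply sqrt_lt_R0; lra).
assert (He : 0 < eps / sqrt 2) by (apply Rdiv_lt_0_compat; lra).
pose proof (proj1 (filterlim_locally f _) Hf (mkposreal _ He)) as Lf.
pose proof (proj1 (filterlim_locally g _) Hg (mkposreal _ He)) as Lg.
generalize (filter_and _ _ Lf Lg); apply filter_imp; intros y [Hy1 Hy2].
replace eps with (sqrt 2 * (eps / sqrt 2)) by (field; lra).
apply Rle_lt_trans with (1 := Cmod_2Rmax _).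
apply Rmult_lt_compat_l; [exact Hs|].
apply Rmax_lub_lt; [exact Hy1|exact Hy2].
Qed.

Lemma continuous_RtoC {U : UniformSpace} (f : U -> R) (x : U) :
  continuous f x -> continuous (fun y => RtoC (f y)) x.
Proof. intros H; apply continuous_Cpair; [exact H|apply continuous_const]. Qed.

Lemma is_derive_C_iff (f : C -> C) (z l : C) :
  is_derive (K := C_AbsRing) (V := C_NormedModule) f z l <->
  forall eps : R, 0 < eps -> exists d : R, 0 < d /\
    forall y, Cmod (y - z) < d ->
      Cmod (f y - f z - (y - z) * l) <= eps * Cmod (y - z).
Proof.
split.
- intros [_ H] eps Heps.
  destruct (H z (fun P HP => HP) (mkposreal eps Heps)) as [d Hd].
  exists d; split; [apply cond_pos|].
  intros y Hy; exact (Hd y Hy).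
- intros H; split; [apply is_linear_scal_l|].
  intros y Hy.
  (* A filter differential quantifies over all limits of the filter; [locally z] has only the limit
     [z]. *)
  apply (is_filter_lim_locally_unique (K := C_AbsRing)
    (V := AbsRing_NormedModule C_AbsRing)) in Hy; subst y.
  intros eps; destruct (H eps (cond_pos eps)) as [d [Hd H']].
  exists (mkposreal d Hd); intros y Hy; exact (H' y Hy).
Qed.

Definition C_differentiable (f : C -> C) (z : C) : Prop :=
  ex_derive (K := C_AbsRing) (V := C_NormedModule) f z.

Lemma differentiable_continuous_C (f : C -> C) (z : C) :
  C_differentiable f z -> continuous f z.
Proof.
intros H.
apply (ex_derive_continuous (K := C_AbsRing) (V := C_NormedModule)) in H.
intros P HP; apply locally_C; apply H; exact HP.
Qed.

(** The difference quotient at 0, completed by f'(0), which is exactly what continuity of [g] at 0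
    requires. *)
Lemma H0_factor (f : C -> C) :
  H0 f ->
  exists g : C -> C,
    (forall z, f z = z * g z)%C /\
    (forall z, z <> RtoC 0 -> g z = f z / z)%C /\
    (forall z : C, continuous g z) /\
    (forall z, z <> RtoC 0 -> C_differentiable g z).
Proof.
intros [Hd H0f].
destruct (Hd (RtoC 0)) as [l0 Hl0].
exists (fun z => if Ceq_dec z (RtoC 0) then l0 else f z / z)%C.
set (g := fun z => if Ceq_dec z (RtoC 0) then l0 else (f z / z)%C).
assert (E : forall z, f z = (z * g z)%C).
{ intros z; unfold g; destruct (Ceq_dec z (RtoC 0)) as [->|Hz].
  - rewrite H0f; ring.
  - field; exact Hz. }
assert (Eg : forall z, z <> RtoC 0 -> g z = (f z / z)%C).
{ intros z Hz; unfold g; destruct (Ceq_dec z (RtoC 0)); [contradiction|reflexivity]. }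
assert (Cg : forall z : C, continuous g z).
{ intros z; destruct (Ceq_dec z (RtoC 0)) as [->|Hz].
  - apply continuous_CC_iff; intros eps Heps.
    destruct (proj1 (is_derive_C_iff f _ _) Hl0 (eps / 2)) as [d [Hdp H']]; [lra|].
    exists d; split; [exact Hdp|].
    intros y Hy; destruct (Ceq_dec y (RtoC 0)) as [->|Hy0].
    + rewrite Cminus_diag, Cmod_0; exact Heps.
    + specialize (H' y Hy); rewrite H0f, E in H'.
      replace (g (RtoC 0)) with l0
        by (unfold g; destruct (Ceq_dec (RtoC 0) (RtoC 0)); congruence).
      replace (y * g y - 0 - (y - 0) * l0)%C with (y * (g y - l0))%C in H' by ring.
      replace (y - 0)%C with y in H' by ring.
      rewrite Cmod_mult, Rmult_comm in H'.
      apply Rmult_le_reg_r in H'; [lra|apply Cmod_gt_0; exact Hy0].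
  - assert (Hzp : 0 < Cmod z) by (apply Cmod_gt_0; exact Hz).
    apply continuous_CC_iff; intros eps Heps.
    pose proof (differentiable_continuous_C f z (Hd z)) as Hc.
    assert (He : 0 < eps * Cmod z / 2) by nra.
    destruct (proj1 (continuous_CC_iff f z) Hc _ (Rdiv_lt_0_compat _ 2 He Rlt_0_2))
      as [d1 [Hd1 H1]].
    assert (Hgz : 0 < Cmod (g z) + 1) by (pose proof (Cmod_ge_0 (g z)); lra).
    set (d2 := eps * Cmod z / 4 / (Cmod (g z) + 1)).
    assert (Hd2 : 0 < d2) by (apply Rdiv_lt_0_compat; lra).
    exists (Rmin (Cmod z / 2) (Rmin d1 d2)); split.
    { repeat apply Rmin_pos; lra. }
    intros y Hy.
    apply Rmin_Rgt_l in Hy as [Hy0 Hy]; apply Rmin_Rgt_l in Hy as [Hy1 Hy2].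
    assert (Hyz : Cmod z / 2 < Cmod y).
    { pose proof (Cmod_triangle y (z - y)) as Ht.
      replace (y + (z - y))%C with z in Ht by ring.
      rewrite Cmod_minus_sym in Ht; lra. }
    (* Each of the two terms of y (g y - g z) = (f y - f z) - (y - z) g z is at most
       [eps * Cmod z / 4]; [Hyz] then allows dividing by [Cmod y]. *)
    assert (Hk : Cmod y * Cmod (g y - g z) < Cmod z / 2 * eps).
    { rewrite <- Cmod_mult.
      replace (y * (g y - g z))%C with ((f y - f z) + - ((y - z) * g z))%C
        by (rewrite !E; ring).
      apply Rle_lt_trans with (1 := Cmod_triangle _ _).
      rewrite Cmod_opp, Cmod_mult.
      specialize (H1 y Hy1).
      assert (Cmod (y - z) * Cmod (g z) <= d2 * (Cmod (g z) + 1)).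
      { apply Rmult_le_compat; try apply Cmod_ge_0; lra. }
      replace (d2 * (Cmod (g z) + 1)) with (eps * Cmod z / 4) in H
        by (unfold d2; field; lra).
      lra. }
    pose proof (Cmod_ge_0 (g y - g z)); nra. }
split; [exact E|split; [exact Eg|split; [exact Cg|]]].
intros z Hz; destruct (Hd z) as [l Hl].
assert (Hzp : 0 < Cmod z) by (apply Cmod_gt_0; exact Hz).
(* This is f' = g + z g' solved for g'. *)
exists ((l - g z) / z)%C; apply is_derive_C_iff; intros eps Heps.
assert (He : 0 < eps * Cmod z / 2) by nra.
destruct (proj1 (is_derive_C_iff f _ _) Hl _ He) as [d1 [Hd1 H1]].
destruct (proj1 (continuous_CC_iff g z) (Cg z) _ He) as [d2 [Hd2 H2]].
exists (Rmin d1 d2); split; [apply Rmin_pos; assumption|].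
intros y Hy; apply Rmin_Rgt_l in Hy as [Hy1 Hy2].
specialize (H1 y Hy1); specialize (H2 y Hy2).
apply Rmult_le_reg_l with (1 := Hzp).
rewrite <- Cmod_mult.
replace (z * (g y - g z - (y - z) * ((l - g z) / z)))%C with
  ((f y - f z - (y - z) * l) + - ((y - z) * (g y - g z)))%C
  by (rewrite !E; field; exact Hz).
apply Rle_trans with (1 := Cmod_triangle _ _).
rewrite Cmod_opp, Cmod_mult.
pose proof (Cmod_ge_0 (y - z)); nra.
Qed.

(** * Integrals along segments *)

Lemma CRInt_correct (f : R -> C) (a b : R) :
  CexRInt f a b -> CisRInt f a b (CRInt f a b).
Proof. exact (RInt_correct (V := C_R_CompleteNormedModule) f a b). Qed.

Lemma CRInt_unique (f : R -> C) (a b : R) (l : C) :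
  CisRInt f a b l -> CRInt f a b = l.
Proof. exact (is_RInt_unique (V := C_R_CompleteNormedModule) f a b l). Qed.

Lemma CRInt_ext (f g : R -> C) (a b : R) :
  (forall t, Rmin a b < t < Rmax a b -> f t = g t) -> CRInt f a b = CRInt g a b.
Proof. exact (RInt_ext (V := C_R_CompleteNormedModule) f g a b). Qed.

Lemma CexRInt_continuous (f : R -> C) (a b : R) :
  (forall t, Rmin a b <= t <= Rmax a b -> continuous f t) -> CexRInt f a b.
Proof. exact (ex_RInt_continuous (V := C_R_CompleteNormedModule) f a b). Qed.

Lemma Cmod_CRInt_le (f : R -> C) (a b M : R) :
  a <= b -> (forall t, a <= t <= b -> Cmod (f t) <= M) -> CexRInt f a b ->
  Cmod (CRInt f a b) <= (b - a) * M.
Proof.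
intros Hab HM Hf; rewrite Cmod_norm.
apply (norm_RInt_le_const (V := C_R_NormedModule) f a b);
  [exact Hab| |apply CRInt_correct; exact Hf].
intros t Ht; generalize (HM t Ht); rewrite Cmod_norm; intros H; exact H.
Qed.

(** The integral is linear over the reals only, so a complex factor is handled through real and
    imaginary parts. *)
Lemma CisRInt_Cmult (c : C) (f : R -> C) (a b : R) (l : C) :
  CisRInt f a b l -> CisRInt (fun t => c * f t)%C a b (c * l)%C.
Proof.
intros H.
pose proof (is_RInt_fct_extend_fst _ _ _ _ H) as H1.
pose proof (is_RInt_fct_extend_snd _ _ _ _ H) as H2.
apply (is_RInt_fct_extend_pair (U := R_NormedModule) (V := R_NormedModule)).
- apply (is_RInt_minus (V := R_NormedModule));
    apply (is_RInt_scal (V := R_NormedModule)); assumption.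
- apply (is_RInt_plus (V := R_NormedModule));
    apply (is_RInt_scal (V := R_NormedModule)); assumption.
Qed.

Lemma CRInt_minus (f g : R -> C) (a b : R) :
  CexRInt f a b -> CexRInt g a b ->
  CRInt (fun t => f t - g t)%C a b = (CRInt f a b - CRInt g a b)%C.
Proof. exact (RInt_minus (V := C_R_CompleteNormedModule) f g a b). Qed.

Lemma CRInt_Chasles (f : R -> C) (a b c : R) :
  CexRInt f a b -> CexRInt f b c ->
  (CRInt f a b + CRInt f b c)%C = CRInt f a c.
Proof. exact (RInt_Chasles (V := C_R_CompleteNormedModule) f a b c). Qed.

Lemma CRInt_comp_lin (f : R -> C) (u v a b : R) :
  CexRInt f (u * a + v) (u * b + v) ->
  CRInt (fun s => RtoC u * f (u * s + v)%R)%C a b =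
  CRInt f (u * a + v) (u * b + v).
Proof.
intros H; rewrite <- (RInt_comp_lin (V := C_R_CompleteNormedModule) f u v a b H).
apply CRInt_ext; intros s _.
symmetry; exact (scal_R_Cmult u (f (u * s + v))).
Qed.

Lemma CRInt_const (a b : R) (c : C) :
  CRInt (fun _ => c) a b = (RtoC (b - a) * c)%C.
Proof.
transitivity (@scal _ C_R_ModuleSpace (b - a) c).
- exact (RInt_const (V := C_R_CompleteNormedModule) a b c).
- exact (scal_R_Cmult (b - a) c).
Qed.

(** The proper counterpart of [seg_int]; [is_RInt01_seg_fun] shows that they agree for continuous
    integrands. *)
Definition segI (g : C -> C) (a b : C) : C := CRInt (seg_fun g a b) 0 1.

Lemma continuous_seg_fun (g : C -> C) (a b : C) (s : R) :
  continuous g (a + RtoC s * (b - a))%C -> continuous (seg_fun g a b) s.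
Proof.
intros Hg; unfold seg_fun.
apply continuous_Cmult; [|apply continuous_const].
apply (continuous_comp (fun s : R => a + RtoC s * (b - a))%C g); [|exact Hg].
apply continuous_Cplus; [apply continuous_const|].
apply continuous_Cmult; [|apply continuous_const].
apply continuous_RtoC, continuous_id.
Qed.

Lemma ex_RInt_seg_fun (g : C -> C) (a b : C) (u v : R) :
  (forall z : C, continuous g z) -> CexRInt (seg_fun g a b) u v.
Proof. intros Hg; apply CexRInt_continuous; intros; apply continuous_seg_fun, Hg. Qed.

(** Since [p] and [q] are in any order, this one reparametrisation yields both the splitting of a
    segment and its reversal ([p = 1], [q = 0]). *)
Lemma segI_affine_param (g : C -> C) (a b : C) (p q : R) :
  (forall z : C, continuous g z) ->
  segI g (a + RtoC p * (b - a)) (a + RtoC q * (b - a)) =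
  CRInt (seg_fun g a b) p q.
Proof.
intros Hg.
transitivity (CRInt (seg_fun g a b) ((q - p) * 0 + p) ((q - p) * 1 + p)).
2: f_equal; ring.
rewrite <- CRInt_comp_lin by (apply ex_RInt_seg_fun, Hg).
unfold segI.
apply CRInt_ext; intros s _; unfold seg_fun.
rewrite RtoC_plus, RtoC_mult, !RtoC_minus.
replace (a + RtoC p * (b - a) +
   RtoC s * (a + RtoC q * (b - a) - (a + RtoC p * (b - a))))%C with
  (a + ((RtoC q - RtoC p) * RtoC s + RtoC p) * (b - a))%C by ring.
ring.
Qed.

Lemma segI_split (g : C -> C) (a b : C) (p : R) :
  (forall z : C, continuous g z) ->
  segI g a b = (segI g a (a + RtoC p * (b - a)) + segI g (a + RtoC p * (b - a)) b)%C.
Proof.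
intros Hg.
replace (segI g a (a + RtoC p * (b - a))) with (CRInt (seg_fun g a b) 0 p).
2: rewrite <- segI_affine_param by exact Hg; f_equal; ring.
replace (segI g (a + RtoC p * (b - a)) b) with (CRInt (seg_fun g a b) p 1).
2: rewrite <- segI_affine_param by exact Hg; f_equal; ring.
symmetry; apply CRInt_Chasles; apply ex_RInt_seg_fun, Hg.
Qed.

Lemma segI_refl (g : C -> C) (a : C) : segI g a a = RtoC 0.
Proof.
unfold segI; transitivity (CRInt (fun _ => RtoC 0) 0 1).
- apply CRInt_ext; intros s _.
  unfold seg_fun; ring.
- rewrite CRInt_const; ring.
Qed.

Lemma segI_swap (g : C -> C) (a b : C) :
  (forall z : C, continuous g z) -> segI g b a = (- segI g a b)%C.
Proof.
intros Hg.
pose proof (CRInt_Chasles (seg_fun g a b) 0 1 0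
  (ex_RInt_seg_fun g a b 0 1 Hg) (ex_RInt_seg_fun g a b 1 0 Hg)) as H.
rewrite <- (segI_affine_param g a b 1 0 Hg) in H.
rewrite <- (segI_affine_param g a b 0 0 Hg), segI_refl in H.
fold (segI g a b) in H.
replace (a + 1 * (b - a))%C with b in H by ring.
replace (a + 0 * (b - a))%C with a in H by ring.
replace (segI g b a) with ((segI g a b + segI g b a) - segI g a b)%C by ring.
rewrite H; ring.
Qed.

Lemma Cmod_segI_le (g : C -> C) (a b : C) (M : R) :
  (forall z : C, continuous g z) ->
  (forall s, 0 <= s <= 1 -> Cmod (g (a + RtoC s * (b - a))%C) <= M) ->
  Cmod (segI g a b) <= M * Cmod (b - a).
Proof.
intros Hg HM; unfold segI.
replace (M * Cmod (b - a)) with ((1 - 0) * (M * Cmod (b - a))) by ring.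
apply Cmod_CRInt_le; [lra| |apply ex_RInt_seg_fun, Hg].
intros s Hs; unfold seg_fun; rewrite Cmod_mult.
apply Rmult_le_compat_r; [apply Cmod_ge_0|apply HM, Hs].
Qed.

Lemma segI_minus (g h : C -> C) (a b : C) :
  (forall z : C, continuous g z) -> (forall z : C, continuous h z) ->
  segI (fun z => g z - h z)%C a b = (segI g a b - segI h a b)%C.
Proof.
intros Hg Hh; unfold segI.
rewrite <- CRInt_minus by (apply ex_RInt_seg_fun; assumption).
apply CRInt_ext; intros s _; unfold seg_fun; ring.
Qed.

(* The integrand takes opposite deviations from its mean at [s] and [1 - s]. *)
Lemma segI_affine (c d a b : C) :
  segI (fun z => c + z * d)%C a b = ((c + (a + b) / RtoC 2 * d) * (b - a))%C.
Proof.
set (g := (fun z => c + z * d)%C).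
assert (Hg : forall z : C, continuous g z).
{ intros z; apply continuous_Cplus; [apply continuous_const|].
  apply continuous_Cmult; [apply continuous_id|apply continuous_const]. }
assert (H : (segI g a b - segI g b a)%C = (RtoC 2 * ((c + (a + b) / RtoC 2 * d) * (b - a)))%C).
{ unfold segI; rewrite <- CRInt_minus by (apply ex_RInt_seg_fun, Hg).
  transitivity (CRInt (fun _ => RtoC 2 * ((c + (a + b) / RtoC 2 * d) * (b - a)))%C 0 1).
  - apply CRInt_ext; intros s _.
    unfold seg_fun, g; field; intros E; apply RtoC_inj in E; lra.
  - rewrite CRInt_const; replace (1 - 0) with 1 by ring; ring. }
rewrite (segI_swap g a b Hg) in H.
assert (H2 : RtoC 2 <> RtoC 0) by (intros E; apply RtoC_inj in E; lra).
replace (segI g a b) with ((segI g a b - - segI g a b) / RtoC 2)%C by (field; exact H2).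
rewrite H; field; exact H2.
Qed.

(** * Integrals around triangles and their midpoint subdivision *)

Definition triI (g : C -> C) (a b c : C) : C :=
  (segI g a b + segI g b c + segI g c a)%C.

Definition Cmid (a b : C) : C := (a + RtoC (1 / 2) * (b - a))%C.

Lemma half_C : RtoC (1 / 2) = (RtoC 1 / RtoC 2)%C.
Proof. apply RtoC_div; lra. Qed.

Lemma two_C_neq0 : RtoC 2 <> RtoC 0.
Proof. intros E; apply RtoC_inj in E; lra. Qed.

Lemma Cmid_sym (a b : C) : Cmid a b = Cmid b a.
Proof. unfold Cmid; rewrite half_C; field; exact two_C_neq0. Qed.

Lemma triI_subdivide (g : C -> C) (a b c : C) :
  (forall z : C, continuous g z) ->
  (triI g a b c =
   triI g a (Cmid a b) (Cmid c a) + triI g (Cmid a b) b (Cmid b c) +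
   triI g (Cmid c a) (Cmid b c) c + triI g (Cmid a b) (Cmid b c) (Cmid c a))%C.
Proof.
intros Hg; unfold triI.
rewrite (segI_split g a b (1 / 2) Hg), (segI_split g b c (1 / 2) Hg),
  (segI_split g c a (1 / 2) Hg); fold (Cmid a b) (Cmid b c) (Cmid c a).
rewrite (segI_swap g (Cmid a b) (Cmid b c) Hg), (segI_swap g (Cmid b c) (Cmid c a) Hg),
  (segI_swap g (Cmid c a) (Cmid a b) Hg).
ring.
Qed.

Lemma Cmod_seg_point_le (a b p : C) (r s : R) :
  Cmod (a - p) <= r -> Cmod (b - p) <= r -> 0 <= s <= 1 ->
  Cmod (a + RtoC s * (b - a) - p) <= r.
Proof.
intros Ha Hb Hs.
replace (a + RtoC s * (b - a) - p)%C with
  (RtoC (1 - s) * (a - p) + RtoC s * (b - p))%C by (rewrite RtoC_minus; ring).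
apply Rle_trans with (1 := Cmod_triangle _ _).
rewrite !Cmod_mult, !Cmod_R, !Rabs_pos_eq by lra; nra.
Qed.

Lemma Cmid_ball (a b p : C) (r : R) :
  Cmod (a - p) <= r -> Cmod (b - p) <= r -> Cmod (Cmid a b - p) <= r.
Proof. intros Ha Hb; apply Cmod_seg_point_le; [assumption..|lra]. Qed.

Lemma Cmid_diff_half (a b c : C) (D : R) :
  Cmod (b - c) <= D -> Cmod (Cmid a b - Cmid a c) <= D / 2.
Proof.
intros H; replace (Cmid a b - Cmid a c)%C with (RtoC (1 / 2) * (b - c))%C
  by (unfold Cmid; ring).
rewrite Cmod_mult, Cmod_R, Rabs_pos_eq by lra; lra.
Qed.

Lemma Cmid_diff_left (a b : C) (D : R) :
  Cmod (a - b) <= D -> Cmod (a - Cmid a b) <= D / 2.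
Proof.
intros H; replace (a - Cmid a b)%C with (RtoC (1 / 2) * (a - b))%C
  by (unfold Cmid; ring).
rewrite Cmod_mult, Cmod_R, Rabs_pos_eq by lra; lra.
Qed.

(** Subtracting the tangent map [h] of [g] at [p] leaves the integral unchanged, because affine maps
    integrate to 0 around a triangle; the remainder is at most [eps * d] on the edges. *)
Lemma triI_small (g : C -> C) (a b c p l : C) (eps d : R) :
  (forall z : C, continuous g z) -> 0 <= eps ->
  Cmod (a - p) <= d -> Cmod (b - p) <= d -> Cmod (c - p) <= d ->
  (forall w, Cmod (w - p) <= d ->
     Cmod (g w - g p - (w - p) * l) <= eps * Cmod (w - p)) ->
  Cmod (triI g a b c) <= eps * d * (Cmod (b - a) + Cmod (c - b) + Cmod (a - c)).
Proof.
intros Hg He Ha Hb Hc Hl.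
set (h := (fun z => (g p - p * l) + z * l)%C).
assert (Hh : forall z : C, continuous h z).
{ intros z; apply continuous_Cplus; [apply continuous_const|].
  apply continuous_Cmult; [apply continuous_id|apply continuous_const]. }
assert (Hgh : forall z : C, continuous (fun z => g z - h z)%C z)
  by (intros z; apply continuous_Cminus; [apply Hg|apply Hh]).
assert (E : triI g a b c = triI (fun z => g z - h z)%C a b c).
{ unfold triI; rewrite !segI_minus by assumption.
  assert (E : triI h a b c = RtoC 0).
  { unfold triI, h; rewrite !segI_affine; field; exact two_C_neq0. }
  unfold triI in E.
  replace (segI g a b + segI g b c + segI g c a)%C with
    (segI g a b + segI g b c + segI g c a - RtoC 0)%C by ring.
  rewrite <- E; ring. }
rewrite E; unfold triI.
assert (S : forall u v, Cmod (u - p) <= d -> Cmod (v - p) <= d ->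
  Cmod (segI (fun z => g z - h z)%C u v) <= eps * d * Cmod (v - u)).
{ intros u v Hu Hv; apply Cmod_segI_le; [exact Hgh|]; intros s Hs.
  pose proof (Cmod_seg_point_le u v p d s Hu Hv Hs) as Hw.
  set (w := (u + RtoC s * (v - u))%C) in *.
  replace (g w - h w)%C with (g w - g p - (w - p) * l)%C by (unfold h; ring).
  apply Rle_trans with (1 := Hl w Hw); apply Rmult_le_compat_l; assumption. }
apply Rle_trans with (1 := Cmod_triangle _ _).
rewrite Rmult_plus_distr_l; apply Rplus_le_compat; [|apply S; assumption].
apply Rle_trans with (1 := Cmod_triangle _ _).
rewrite Rmult_plus_distr_l; apply Rplus_le_compat; apply S; assumption.
Qed.

(** * Goursat's theorem *)

Record triangle := Triangle { vtx1 : C; vtx2 : C; vtx3 : C }.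

Definition tri_int (g : C -> C) (T : triangle) : C :=
  triI g (vtx1 T) (vtx2 T) (vtx3 T).

(** Discs are convex, so conditions on the vertices suffice to place the edges. *)
Definition tri_within (T : triangle) (p : C) (r : R) : Prop :=
  Cmod (vtx1 T - p) <= r /\ Cmod (vtx2 T - p) <= r /\ Cmod (vtx3 T - p) <= r.

Definition tri_diam (T : triangle) (D : R) : Prop :=
  Cmod (vtx2 T - vtx1 T) <= D /\ Cmod (vtx3 T - vtx2 T) <= D /\
  Cmod (vtx1 T - vtx3 T) <= D.

(** Nesting is expressed by discs: any disc that holds [T] holds [T']. This spares treating
    triangles as point sets. *)
Definition tri_refines (g : C -> C) (T T' : triangle) : Prop :=
  Cmod (tri_int g T) <= 4 * Cmod (tri_int g T') /\
  (forall p r, tri_within T p r -> tri_within T' p r) /\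
  (forall D, tri_diam T D -> tri_diam T' (D / 2)).

Lemma tri_refinement (g : C -> C) (T : triangle) :
  (forall z : C, continuous g z) -> { T' : triangle | tri_refines g T T' }.
Proof.
intros Hg; destruct T as [a b c].
set (T1 := Triangle a (Cmid a b) (Cmid c a)).
set (T2 := Triangle (Cmid a b) b (Cmid b c)).
set (T3 := Triangle (Cmid c a) (Cmid b c) c).
set (T4 := Triangle (Cmid a b) (Cmid b c) (Cmid c a)).
assert (W : forall T', In T' (T1 :: T2 :: T3 :: T4 :: nil)%list ->
  Cmod (tri_int g (Triangle a b c)) <= 4 * Cmod (tri_int g T') ->
  tri_refines g (Triangle a b c) T').
{ intros T' HT' Hle; split; [exact Hle|split].
  - intros p r (Ha & Hb & Hc); simpl in *; unfold tri_within.
    repeat destruct HT' as [<-|HT']; [..|contradiction]; simpl;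
      repeat split; try assumption; apply Cmid_ball; assumption.
  - intros D (H1 & H2 & H3); simpl in *; unfold tri_diam.
    assert (H1' := H1); assert (H2' := H2); assert (H3' := H3).
    rewrite Cmod_minus_sym in H1', H2', H3'.
    repeat destruct HT' as [<-|HT']; [..|contradiction]; simpl;
      repeat split.
    + rewrite Cmod_minus_sym; apply Cmid_diff_left; assumption.
    + rewrite (Cmid_sym c a); apply Cmid_diff_half; assumption.
    + rewrite (Cmid_sym c a); apply Cmid_diff_left; assumption.
    + rewrite (Cmid_sym a b); apply Cmid_diff_left; assumption.
    + rewrite Cmod_minus_sym; apply Cmid_diff_left; assumption.
    + rewrite (Cmid_sym a b); apply Cmid_diff_half; assumption.
    + rewrite (Cmid_sym b c); apply Cmid_diff_half; assumption.
    + rewrite (Cmid_sym b c); apply Cmid_diff_left; assumption.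
    + rewrite Cmod_minus_sym; apply Cmid_diff_left; assumption.
    + rewrite (Cmid_sym a b); apply Cmid_diff_half; assumption.
    + rewrite (Cmid_sym b c); apply Cmid_diff_half; assumption.
    + rewrite (Cmid_sym c a); apply Cmid_diff_half; assumption. }
pose proof (triI_subdivide g a b c Hg) as S.
assert (Ht : Cmod (tri_int g (Triangle a b c)) <=
  Cmod (tri_int g T1) + Cmod (tri_int g T2) + Cmod (tri_int g T3) + Cmod (tri_int g T4)).
{ unfold tri_int at 1; simpl; rewrite S.
  apply Rle_trans with (1 := Cmod_triangle _ _), Rplus_le_compat_r.
  apply Rle_trans with (1 := Cmod_triangle _ _), Rplus_le_compat_r.
  apply Cmod_triangle. }
set (I0 := Cmod (tri_int g (Triangle a b c))) in *.
(* Four numbers adding up to at least [I0] cannot all be below [I0 / 4]. The choice uses [Rle_dec]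
   because the result is a sigma type, to be iterated as a function. *)
destruct (Rle_dec I0 (4 * Cmod (tri_int g T1))) as [|N1];
  [exists T1; apply W; simpl; tauto|].
destruct (Rle_dec I0 (4 * Cmod (tri_int g T2))) as [|N2];
  [exists T2; apply W; simpl; tauto|].
destruct (Rle_dec I0 (4 * Cmod (tri_int g T3))) as [|N3];
  [exists T3; apply W; simpl; tauto|].
exists T4; apply W; [simpl; tauto|lra].
Qed.

(** The refinements contract to a point [p] of the disc. Differentiability at [p] bounds the n-th
    integral by a small multiple of (D / 2^n)^2, which compensates the factor 4^n lost in n
    refinements. *)
Lemma goursat (g : C -> C) (T : triangle) (z : C) (r : R) :
  (forall w : C, continuous g w) ->
  tri_within T z r -> (forall w, Cmod (w - z) <= r -> C_differentiable g w) ->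
  tri_int g T = RtoC 0.
Proof.
intros Hg Hin Hd.
set (Ts := fun n => Nat.iter n (fun T => proj1_sig (tri_refinement g T Hg)) T).
assert (HS : forall n, tri_refines g (Ts n) (Ts (S n)))
  by (intros n; exact (proj2_sig (tri_refinement g (Ts n) Hg))).
set (D := Cmod (vtx2 T - vtx1 T) + Cmod (vtx3 T - vtx2 T) + Cmod (vtx1 T - vtx3 T)).
assert (HD0 : tri_diam T D).
{ pose proof (Cmod_ge_0 (vtx2 T - vtx1 T)); pose proof (Cmod_ge_0 (vtx3 T - vtx2 T));
  pose proof (Cmod_ge_0 (vtx1 T - vtx3 T)); unfold D; repeat split; lra. }
assert (HDp : 0 <= D) by (apply Rle_trans with (2 := proj1 HD0), Cmod_ge_0).
assert (H2n : forall n, 0 < 2 ^ n) by (intros n; apply pow_lt; lra).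
assert (HDn : forall n, tri_diam (Ts n) (D / 2 ^ n)).
{ induction n as [|n IH]; [simpl; rewrite Rdiv_1_r; exact HD0|].
  replace (D / 2 ^ S n) with (D / 2 ^ n / 2)
    by (simpl; field; apply Rgt_not_eq, H2n).
  apply HS; exact IH. }
assert (HIn : forall n, Cmod (tri_int g T) <= 4 ^ n * Cmod (tri_int g (Ts n))).
{ induction n as [|n IH]; [simpl; rewrite Rmult_1_l; apply Rle_refl|].
  apply Rle_trans with (1 := IH).
  rewrite <- tech_pow_Rmult, (Rmult_comm 4), Rmult_assoc.
  apply Rmult_le_compat_l; [apply pow_le; lra|apply HS]. }
assert (Hwn : forall n m p s, (n <= m)%nat -> tri_within (Ts n) p s -> tri_within (Ts m) p s).
{ intros n m p s Hnm H; induction Hnm as [|m Hnm IH]; [exact H|].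
  apply (HS m); exact IH. }
assert (Hself : forall n, tri_within (Ts n) (vtx1 (Ts n)) (D / 2 ^ n)).
{ intros n; destruct (HDn n) as (H1 & H2 & H3); repeat split; [|exact H1|].
  - rewrite Cminus_diag, Cmod_0; apply Rdiv_le_0_compat; [exact HDp|apply H2n].
  - rewrite Cmod_minus_sym; exact H3. }
assert (Hsmall : forall e, 0 < e -> exists n, D / 2 ^ n < e).
{ intros e He.
  assert (Hh : Rabs (/ 2) < 1) by (rewrite Rabs_pos_eq; lra).
  destruct (pow_lt_1_zero (/ 2) Hh (e / (D + 1))) as [N HN]; [apply Rdiv_lt_0_compat; lra|].
  exists N; specialize (HN N (le_n N)).
  rewrite Rabs_pos_eq in HN by (apply pow_le; lra).
  rewrite pow_inv in HN.
  apply Rmult_lt_compat_r with (r := D + 1) in HN; [|lra].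
  replace (e / (D + 1) * (D + 1)) with e in HN by (field; lra).
  unfold Rdiv; pose proof (Rinv_0_lt_compat _ (H2n N)); nra. }
(* From index [N] on, all first vertices stay within D / 2^N of that of [Ts N], so they form a
   Cauchy sequence. *)
assert (Hlim : exists p : C, filterlim (fun n => vtx1 (Ts n)) eventually
                 (locally (T := C_UniformSpace) p)).
{ apply (filterlim_locally_cauchy (U := C_R_CompleteNormedModule)).
  intros eps; destruct (Hsmall (eps / 2)) as [N HN]; [apply Rdiv_lt_0_compat; [apply cond_pos|lra]|].
  exists (fun n => (N <= n)%nat); split; [exists N; intros n Hn; exact Hn|].
  intros n m Hn Hm; apply C_NormedModule_mixin_compat1.
  change (Cmod (vtx1 (Ts m) - vtx1 (Ts n)) < eps).
  apply Rle_lt_trans with (1 := Cmod_minus_le _ (vtx1 (Ts N)) _).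
  rewrite (Cmod_minus_sym (vtx1 (Ts N))).
  pose proof (proj1 (Hwn N n _ _ Hn (Hself N))).
  pose proof (proj1 (Hwn N m _ _ Hm (Hself N))).
  lra. }
destruct Hlim as [p Hp].
(* A closed disc that holds one triangle holds all later ones, hence also the limit [p]. *)
assert (Hcl : forall q s, (exists N, tri_within (Ts N) q s) -> Cmod (p - q) <= s).
{ intros q s [N HN]; apply le_epsilon; intros e He.
  destruct (proj1 (filterlim_C_iff _ _ _) Hp e He) as [M HM].
  specialize (HM (max N M) (Nat.le_max_r _ _)).
  rewrite Cmod_minus_sym in HM.
  pose proof (proj1 (Hwn N (max N M) _ _ (Nat.le_max_l _ _) HN)).
  pose proof (Cmod_minus_le p (vtx1 (Ts (max N M))) q); lra. }
assert (Hpz : Cmod (p - z) <= r) by (apply Hcl; exists O; exact Hin).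
destruct (Hd p Hpz) as [l Hl].
apply Cmod_eq_0, Rle_antisym; [|apply Cmod_ge_0].
apply le_epsilon; intros e He; rewrite Rplus_0_l.
(* The 6 is 2 * 3: radius 2 D / 2^n around [p] times perimeter at most 3 D / 2^n. Adding 1 keeps the
   denominator positive when [D = 0]. *)
set (e' := e / (6 * (D * D) + 1)).
assert (He' : 0 < e') by (apply Rdiv_lt_0_compat; nra).
destruct (proj1 (is_derive_C_iff _ _ _) Hl e' He') as [d [Hdp H']].
destruct (Hsmall (d / 2)) as [n Hn]; [lra|].
(* Both [p] and the vertices are within D / 2^n of the first vertex, whence the factor 2 and the
   choice of [n] with D / 2^n < d / 2. *)
assert (Hwp : tri_within (Ts n) p (2 * (D / 2 ^ n))).
{ assert (Hpa : Cmod (vtx1 (Ts n) - p) <= D / 2 ^ n)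
    by (rewrite Cmod_minus_sym; apply Hcl; exists n; apply Hself).
  destruct (Hself n) as (_ & H2 & H3).
  pose proof (Cmod_ge_0 (vtx1 (Ts n) - p)).
  repeat split; [lra| |].
  - pose proof (Cmod_minus_le (vtx2 (Ts n)) (vtx1 (Ts n)) p); lra.
  - pose proof (Cmod_minus_le (vtx3 (Ts n)) (vtx1 (Ts n)) p); lra. }
assert (HI : Cmod (tri_int g (Ts n)) <= e' * (2 * (D / 2 ^ n)) * (3 * (D / 2 ^ n))).
{ destruct Hwp as (W1 & W2 & W3); destruct (HDn n) as (D1 & D2 & D3).
  eapply Rle_trans.
  - apply (triI_small g _ _ _ p l e' (2 * (D / 2 ^ n))); try assumption; [lra|].
    intros w Hw; apply H'; lra.
  - apply Rmult_le_compat_l; [|lra].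
    apply Rmult_le_pos; [lra|]; pose proof (Cmod_ge_0 (vtx1 (Ts n) - p)); lra. }
apply Rle_trans with (1 := HIn n).
apply Rle_trans with (4 ^ n * (e' * (2 * (D / 2 ^ n)) * (3 * (D / 2 ^ n)))).
{ apply Rmult_le_compat_l; [apply pow_le; lra|exact HI]. }
replace (4 ^ n) with (2 ^ n * 2 ^ n) by (rewrite <- Rpow_mult_distr; f_equal; ring).
replace (2 ^ n * 2 ^ n * (e' * (2 * (D / 2 ^ n)) * (3 * (D / 2 ^ n))))
  with (e' * (6 * (D * D))) by (field; apply Rgt_not_eq, H2n).
replace e with (e' * (6 * (D * D) + 1)) by (unfold e'; field; nra).
apply Rmult_le_compat_l; lra.
Qed.

(** * Primitives of continuous functions that are differentiable off the origin *)

(** By continuity [g] is bounded near 0, so the integral around the small corner triangle is of the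
    order of its perimeter and tends to 0 with it. *)
Lemma tri_int_vertex0 (g : C -> C) (z w : C) :
  (forall u : C, continuous g u) ->
  (forall u, u <> RtoC 0 -> C_differentiable g u) ->
  Cmod (w - z) < Cmod z -> triI g (RtoC 0) z w = RtoC 0.
Proof.
intros Hg Hd Hzw.
assert (Hz : 0 < Cmod z) by (pose proof (Cmod_ge_0 (w - z)); lra).
(* Cutting off the corner at 0 leaves two triangles inside the disc
   |u - z| < |z|, which omits 0. *)
assert (K : forall e, 0 < e < 1 ->
  triI g (RtoC 0) z w = triI g (RtoC 0) (RtoC e * z) (RtoC e * w)).
{ intros e He.
  set (r := Rmax (Cmod (w - z)) (Rmax (Cmod (RtoC e * z - z)) (Cmod (RtoC e * w - z)))).
  assert (Hr : r < Cmod z).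
  { unfold r; repeat apply Rmax_lub_lt; [exact Hzw| |].
    - replace (RtoC e * z - z)%C with (RtoC (e - 1) * z)%C by (rewrite RtoC_minus; ring).
      rewrite Cmod_mult, Cmod_R, Rabs_left by lra; nra.
    - replace (RtoC e * w - z)%C with (RtoC e * (w - z) + RtoC (e - 1) * z)%C
        by (rewrite RtoC_minus; ring).
      apply Rle_lt_trans with (1 := Cmod_triangle _ _).
      rewrite !Cmod_mult, !Cmod_R, Rabs_pos_eq, Rabs_left by lra; nra. }
  assert (R1 : Cmod (w - z) <= r) by apply Rmax_l.
  assert (R2 : Cmod (RtoC e * z - z) <= r)
    by (apply Rle_trans with (2 := Rmax_r _ _), Rmax_l).
  assert (R3 : Cmod (RtoC e * w - z) <= r)
    by (apply Rle_trans with (2 := Rmax_r _ _), Rmax_r).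
  assert (R0 : Cmod (z - z) <= r).
  { rewrite Cminus_diag, Cmod_0; apply Rle_trans with (2 := R1), Cmod_ge_0. }
  assert (Hdr : forall u, Cmod (u - z) <= r -> C_differentiable g u).
  { intros u Hu; apply Hd; intros ->.
    replace (0 - z)%C with (- z)%C in Hu by ring; rewrite Cmod_opp in Hu; lra. }
  pose proof (goursat g (Triangle (RtoC e * z) z w) z r Hg
    (conj R2 (conj R0 R1)) Hdr) as G1.
  pose proof (goursat g (Triangle (RtoC e * z) w (RtoC e * w)) z r Hg
    (conj R2 (conj R1 R3)) Hdr) as G2.
  unfold tri_int, triI in G1, G2 |- *; simpl in G1, G2.
  rewrite (segI_split g (RtoC 0) z e Hg), (segI_swap g (RtoC 0) w Hg),
    (segI_split g (RtoC 0) w e Hg), (segI_swap g (RtoC 0) (RtoC e * w) Hg).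
  replace (0 + RtoC e * (z - 0))%C with (RtoC e * z)%C by ring.
  replace (0 + RtoC e * (w - 0))%C with (RtoC e * w)%C by ring.
  rewrite (segI_swap g (RtoC e * w) (RtoC e * z) Hg) in *.
  rewrite (segI_swap g (RtoC e * w) w Hg) in G2.
  rewrite (segI_swap g (RtoC e * z) w Hg) in G1.
  (* The large triangle is the corner plus the triangles of [G1] and [G2]; the inner edges, now
     oriented consistently, cancel. *)
  match type of G1 with ?A = _ => match type of G2 with ?B = _ =>
    match goal with |- _ = ?Y => transitivity (Y + A + B)%C;
      [ring|rewrite G1, G2; ring] end end end. }
apply Cmod_eq_0, Rle_antisym; [|apply Cmod_ge_0].
apply le_epsilon; intros e He; rewrite Rplus_0_l.
destruct (proj1 (continuous_CC_iff g (RtoC 0)) (Hg _) 1 Rlt_0_1) as [d [Hdp H']].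
set (M := Cmod (g (RtoC 0)) + 1).
assert (HM : 0 < M) by (pose proof (Cmod_ge_0 (g (RtoC 0))); unfold M; lra).
assert (Hw : Cmod w < 2 * Cmod z).
{ pose proof (Cmod_triangle (w - z) z) as Ht.
  replace (w - z + z)%C with w in Ht by ring; lra. }
set (L := Cmod z).
(* The three bounds give s < 1, a corner within distance d / 2 of 0, where [M] bounds [g], and an
   integral of at most 4 s M L <= e / 2: the edges have lengths at most s L, s L and 2 s L. *)
set (s := Rmin (1 / 2) (Rmin (d / (4 * L)) (e / (8 * M * L)))).
assert (HL : 0 < L) by exact Hz.
assert (Hs : 0 < s).
{ unfold s; repeat apply Rmin_pos; [lra|apply Rdiv_lt_0_compat; nra|].
  apply Rdiv_lt_0_compat; [lra|]; nra. }
assert (Hs1 : s <= 1 / 2) by apply Rmin_l.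
assert (Hs2 : s * (4 * L) <= d).
{ replace d with (d / (4 * L) * (4 * L)) by (field; lra).
  apply Rmult_le_compat_r; [lra|].
  apply Rle_trans with (1 := Rmin_r _ _), Rmin_l. }
assert (Hs3 : s * (8 * M * L) <= e).
{ replace e with (e / (8 * M * L) * (8 * M * L)) by (field; lra).
  apply Rmult_le_compat_r; [nra|].
  apply Rle_trans with (1 := Rmin_r _ _), Rmin_r. }
rewrite (K s) by lra.
assert (B : forall u v, Cmod u <= s * (2 * L) -> Cmod v <= s * (2 * L) ->
  Cmod (segI g u v) <= M * Cmod (v - u)).
{ intros u v Hu Hv; apply Cmod_segI_le; [exact Hg|]; intros t Ht.
  assert (Hq : Cmod (u + RtoC t * (v - u) - 0) <= s * (2 * L)).
  { apply Cmod_seg_point_le; [| |exact Ht].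
    - replace (u - 0)%C with u by ring; exact Hu.
    - replace (v - 0)%C with v by ring; exact Hv. }
  assert (Hq' : Cmod (u + RtoC t * (v - u) - 0) < d) by nra.
  specialize (H' _ Hq').
  pose proof (Cmod_triangle (g (u + RtoC t * (v - u))%C - g (RtoC 0)) (g (RtoC 0))) as Ht'.
  replace (g (u + RtoC t * (v - u))%C - g (RtoC 0) + g (RtoC 0))%C
    with (g (u + RtoC t * (v - u))%C) in Ht' by ring.
  unfold M; lra. }
assert (N0 : Cmod (RtoC 0) <= s * (2 * L)) by (rewrite Cmod_0; nra).
assert (N1 : Cmod (RtoC s * z) = s * L) by (rewrite Cmod_mult, Cmod_R, Rabs_pos_eq; unfold L; lra).
assert (N2 : Cmod (RtoC s * w) <= s * (2 * L)).
{ rewrite Cmod_mult, Cmod_R, Rabs_pos_eq by lra; unfold L; nra. }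
assert (N1' : Cmod (RtoC s * z) <= s * (2 * L)) by (rewrite N1; nra).
pose proof (B _ _ N0 N1') as B1; pose proof (B _ _ N1' N2) as B2; pose proof (B _ _ N2 N0) as B3.
replace (RtoC s * z - 0)%C with (RtoC s * z)%C in B1 by ring.
replace (0 - RtoC s * w)%C with (- (RtoC s * w))%C in B3 by ring.
rewrite Cmod_opp in B3.
replace (RtoC s * w - RtoC s * z)%C with (RtoC s * (w - z))%C in B2 by ring.
rewrite (Cmod_mult (RtoC s)), (Cmod_R s), (Rabs_pos_eq s) in B2 by lra.
unfold triI.
apply Rle_trans with (1 := Cmod_triangle _ _).
pose proof (Cmod_triangle (segI g (RtoC 0) (RtoC s * z)) (segI g (RtoC s * z) (RtoC s * w))).
assert (s * Cmod (w - z) <= s * L) by (unfold L; nra).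
assert (M * (s * Cmod (w - z)) <= M * (s * L)) by nra.
assert (M * Cmod (RtoC s * w) <= M * (s * (2 * L))) by nra.
rewrite N1 in B1; nra.
Qed.

(** For [w] near [z] the triangle 0, z, w reduces the increment of the primitive to [segI g z w],
    and continuity of [g] at [z] does the rest. At [z = 0] the reduction is trivial, so the
    primitive is differentiable there too. *)
Lemma primitive_from_0 (g : C -> C) (z : C) :
  (forall u : C, continuous g u) ->
  (forall u, u <> RtoC 0 -> C_differentiable g u) ->
  is_derive (K := C_AbsRing) (V := C_NormedModule) (segI g (RtoC 0)) z (g z).
Proof.
intros Hg Hd; apply is_derive_C_iff; intros eps Heps.
destruct (proj1 (continuous_CC_iff g z) (Hg _) eps Heps) as [d [Hdp H']].
assert (Hloc : exists d0, 0 < d0 /\ forall w, Cmod (w - z) < d0 ->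
  (segI g (RtoC 0) w - segI g (RtoC 0) z)%C = segI g z w).
{ destruct (Ceq_dec z (RtoC 0)) as [->|Hz].
  - exists 1; split; [lra|]; intros w _; rewrite segI_refl; ring.
  - exists (Cmod z); split; [apply Cmod_gt_0; exact Hz|]; intros w Hw.
    pose proof (tri_int_vertex0 g z w Hg Hd Hw) as T; unfold triI in T.
    rewrite (segI_swap g (RtoC 0) w Hg) in T.
    replace (segI g z w) with
      (segI g (RtoC 0) z + segI g z w + - segI g (RtoC 0) w
       + (segI g (RtoC 0) w - segI g (RtoC 0) z))%C by ring.
    rewrite T; ring. }
destruct Hloc as [d0 [Hd0 Hloc]].
exists (Rmin d0 d); split; [apply Rmin_pos; assumption|].
intros w Hw; apply Rmin_Rgt_l in Hw as [Hw0 Hw].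
rewrite (Hloc w Hw0).
assert (E : (segI g z w - (w - z) * g z)%C = segI (fun u => g u - g z)%C z w).
{ rewrite (segI_minus g (fun _ => g z)) by (assumption || intros; apply continuous_const).
  f_equal; f_equal; unfold segI, seg_fun; rewrite CRInt_const.
  replace (1 - 0) with 1 by ring; ring. }
rewrite E; apply Cmod_segI_le.
- intros u; apply continuous_Cminus; [apply Hg|apply continuous_const].
- intros s Hs; apply Rlt_le, H'.
  replace (z + RtoC s * (w - z) - z)%C with (RtoC s * (w - z))%C by ring.
  rewrite Cmod_mult, Cmod_R, Rabs_pos_eq by lra.
  pose proof (Cmod_ge_0 (w - z)); nra.
Qed.

(** * Improper integrals over the open unit interval *)

Lemma at_right_0_iff (P : R -> Prop) :
  at_right 0 P <-> exists d, 0 < d /\ forall u, 0 < u < d -> P u.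
Proof.
split.
- intros [d H]; exists d; split; [apply cond_pos|]; intros u Hu; apply H; [|lra].
  change (Rabs (u - 0) < d); rewrite Rminus_0_r, Rabs_pos_eq; lra.
- intros (d & Hd & H); exists (mkposreal d Hd); intros u Hu H0; apply H.
  change (Rabs (u - 0) < d) in Hu; rewrite Rminus_0_r, Rabs_pos_eq in Hu; lra.
Qed.

Lemma at_left_iff (b : R) (P : R -> Prop) :
  at_left b P <-> exists d, 0 < d /\ forall v, b - d < v < b -> P v.
Proof.
split.
- intros [d H]; exists d; split; [apply cond_pos|]; intros v Hv; apply H; [|lra].
  change (Rabs (v - b) < d); rewrite Rabs_left; lra.
- intros (d & Hd & H); exists (mkposreal d Hd); intros v Hv H0; apply H.
  change (Rabs (v - b) < d) in Hv; rewrite Rabs_left in Hv; lra.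
Qed.

(** The conditions [u < 1] and [0 < v] matter when [d] is large: integrability is assumed only
    between points of the open interval. *)
Lemma is_RInt01_iff (f : R -> C) (l : C) :
  (forall u v, 0 < u < 1 -> 0 < v < 1 -> CexRInt f u v) ->
  (is_RInt01 f l <->
   forall eps, 0 < eps -> exists d, 0 < d /\
     forall u v, 0 < u < d -> u < 1 -> 1 - d < v < 1 -> 0 < v ->
       Cmod (CRInt f u v - l) < eps).
Proof.
intros Hf; split.
- intros H eps Heps.
  assert (L : locally (T := C_UniformSpace) l (fun y : C => Cmod (y - l) < eps)).
  { exact (proj1 (filterlim_C_iff (locally (T := C_UniformSpace) l) (fun y => y) l)
      (filterlim_id C _) eps Heps). }
  destruct (H _ L) as [Q1 Q2 HQ1 HQ2 HQ].
  apply at_right_0_iff in HQ1 as (d1 & Hd1 & HQ1).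
  apply at_left_iff in HQ2 as (d2 & Hd2 & HQ2).
  exists (Rmin d1 d2); split; [apply Rmin_pos; assumption|].
  intros u v Hu Hu1 Hv Hv0.
  pose proof (Rmin_l d1 d2); pose proof (Rmin_r d1 d2).
  destruct (HQ u v) as (y & Hy & Hyl); [apply HQ1; lra|apply HQ2; lra|].
  rewrite (CRInt_unique f u v y Hy); exact Hyl.
- intros H P HP; destruct HP as [eps HP].
  destruct (H eps (cond_pos eps)) as (d & Hd & H').
  exists (fun u => 0 < u < Rmin d 1) (fun v => 1 - Rmin d 1 < v < 1).
  + apply at_right_0_iff; exists (Rmin d 1); split; [apply Rmin_pos; lra|auto].
  + apply at_left_iff; exists (Rmin d 1); split; [apply Rmin_pos; lra|auto].
  + intros u v Hu Hv.
    pose proof (Rmin_l d 1); pose proof (Rmin_r d 1).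
    exists (CRInt f u v); split; [apply CRInt_correct, Hf; simpl; lra|].
    apply HP, C_NormedModule_mixin_compat1, H'; lra.
Qed.

Lemma RInt01_unique (f : R -> C) (l : C) :
  is_RInt01 f l ->
  RInt_gen (V := C_R_CompleteNormedModule) f (at_right 0) (at_left 1) = l.
Proof. exact (is_RInt_gen_unique (V := C_R_CompleteNormedModule) f l). Qed.

Lemma is_RInt01_ext (f g : R -> C) (l : C) :
  (forall t, 0 < t < 1 -> f t = g t) -> is_RInt01 f l -> is_RInt01 g l.
Proof.
intros E; apply is_RInt_gen_ext.
exists (fun u => 0 < u < 1) (fun v => 1 - 1 < v < 1).
- apply at_right_0_iff; exists 1; split; [lra|auto].
- apply at_left_iff; exists 1; split; [lra|auto].
- intros u v Hu Hv t Ht; apply E; simpl in Ht.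
  unfold Rmin, Rmax in Ht; destruct (Rle_dec u v); lra.
Qed.

Lemma is_RInt01_Cmult (c : C) (f : R -> C) (l : C) :
  is_RInt01 f l -> is_RInt01 (fun t => c * f t)%C (c * l)%C.
Proof.
intros H P HP.
assert (Hc : continuous (fun y : C => c * y)%C l)
  by (apply continuous_Cmult; [apply continuous_const|apply continuous_id]).
destruct (H _ (Hc P HP)) as [Q1 Q2 HQ1 HQ2 HQ].
exists Q1 Q2; [exact HQ1|exact HQ2|].
intros u v Hu Hv; destruct (HQ u v Hu Hv) as (y & Hy & HPy).
exists (c * y)%C; split; [apply CisRInt_Cmult, Hy|exact HPy].
Qed.

(** [Phi] stands for a primitive of a majorant of [f]. Its continuity at 0 and 1, where [f] may blow
    up, is what makes the end pieces small. *)
Lemma ex_RInt01_cauchy (f : R -> C) (Phi : R -> R) :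
  (forall t, 0 < t < 1 -> continuous f t) ->
  (forall u v, 0 < u -> u <= v -> v < 1 -> Cmod (CRInt f u v) <= Phi v - Phi u) ->
  (forall t, continuous Phi t) ->
  exists l, is_RInt01 f l.
Proof.
intros Hf Hb HP.
assert (Hex : forall u v, 0 < u < 1 -> 0 < v < 1 -> CexRInt f u v).
{ intros u v Hu Hv; apply CexRInt_continuous; intros t Ht; apply Hf.
  unfold Rmin, Rmax in Ht; destruct (Rle_dec u v); lra. }
assert (Hb' : forall u v, 0 < u < 1 -> 0 < v < 1 ->
  Cmod (CRInt f u v) <= Rabs (Phi v - Phi u)).
{ intros u v Hu Hv; destruct (Rle_dec u v) as [Huv|Huv].
  - apply Rle_trans with (2 := Rle_abs _), Hb; lra.
  - replace (CRInt f u v) with (- CRInt f v u)%C.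
    2: exact (opp_RInt_swap (V := C_R_CompleteNormedModule) f v u (Hex v u Hv Hu)).
    rewrite Cmod_opp, Rabs_minus_sym.
    apply Rle_trans with (2 := Rle_abs _), Hb; lra. }
destruct (proj1 (filterlim_locally_cauchy (U := C_R_CompleteNormedModule)
  (F := filter_prod (at_right 0) (at_left 1)) (fun p => CRInt f (fst p) (snd p))))
  as [l Hl].
{ intros eps.
  assert (He : 0 < eps / 4) by (apply Rdiv_lt_0_compat; [apply cond_pos|lra]).
  assert (Hc : forall b, exists d, 0 < d /\ forall t, Rabs (t - b) < d ->
     Rabs (Phi t - Phi b) < eps / 4).
  { intros b; destruct (proj1 (filterlim_locally Phi _) (HP b) (mkposreal _ He)) as [d Hd].
    exists d; split; [apply cond_pos|]; intros t Ht; exact (Hd t Ht). }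
  destruct (Hc 0) as (d0 & Hd0 & H0); destruct (Hc 1) as (d1 & Hd1 & H1).
  exists (fun p => (0 < fst p < Rmin d0 1) /\ (1 - Rmin d1 1 < snd p < 1)); split.
  { exists (fun u => 0 < u < Rmin d0 1) (fun v => 1 - Rmin d1 1 < v < 1).
    - apply at_right_0_iff; exists (Rmin d0 1); split; [apply Rmin_pos; lra|auto].
    - apply at_left_iff; exists (Rmin d1 1); split; [apply Rmin_pos; lra|auto].
    - intros u v Hu Hv; split; assumption. }
  intros [u v] [u' v'] [Hu Hv] [Hu' Hv']; simpl in *.
  apply C_NormedModule_mixin_compat1.
  change (Cmod (CRInt f u' v' - CRInt f u v) < eps).
  pose proof (Rmin_l d0 1); pose proof (Rmin_r d0 1).
  pose proof (Rmin_l d1 1); pose proof (Rmin_r d1 1).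
  (* Two truncations differ by one piece at each end. Each is below eps / 2, since [Phi] varies by
     less than eps / 4 from its end value. *)
  assert (E : (CRInt f u' v' - CRInt f u v)%C = (CRInt f u' u + CRInt f v v')%C).
  { rewrite <- (CRInt_Chasles f u' u v') by (apply Hex; lra).
    rewrite <- (CRInt_Chasles f u v v') by (apply Hex; lra). ring. }
  rewrite E; apply Rle_lt_trans with (1 := Cmod_triangle _ _).
  pose proof (Hb' u' u ltac:(lra) ltac:(lra)); pose proof (Hb' v v' ltac:(lra) ltac:(lra)).
  assert (A1 := H0 u ltac:(rewrite Rminus_0_r, Rabs_pos_eq; lra)).
  assert (A2 := H0 u' ltac:(rewrite Rminus_0_r, Rabs_pos_eq; lra)).
  assert (A3 := H1 v ltac:(rewrite Rabs_left; lra)).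
  assert (A4 := H1 v' ltac:(rewrite Rabs_left; lra)).
  assert (Rabs (Phi u - Phi u') < eps / 2).
  { apply Rabs_def2 in A1, A2; apply Rabs_def1; lra. }
  assert (Rabs (Phi v' - Phi v) < eps / 2).
  { apply Rabs_def2 in A3, A4; apply Rabs_def1; lra. }
  lra. }
exists l; apply is_RInt01_iff; [exact Hex|].
intros eps Heps.
destruct (proj1 (filterlim_C_iff (filter_prod (at_right 0) (at_left 1)) _ l) Hl eps Heps)
  as [Q1 Q2 HQ1 HQ2 HQ].
apply at_right_0_iff in HQ1 as (d1 & Hd1 & HQ1).
apply at_left_iff in HQ2 as (d2 & Hd2 & HQ2).
exists (Rmin d1 d2); split; [apply Rmin_pos; assumption|].
intros u v Hu Hu1 Hv Hv0.
pose proof (Rmin_l d1 d2); pose proof (Rmin_r d1 d2).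
apply (HQ u v); [apply HQ1; lra|apply HQ2; lra].
Qed.

Lemma is_RInt01_continuous (f : R -> C) :
  (forall t, continuous f t) -> is_RInt01 f (CRInt f 0 1).
Proof.
intros Hf.
assert (Hex : forall u v, CexRInt f u v)
  by (intros; apply CexRInt_continuous; intros; apply Hf).
destruct (bounded_continuity (V := C_R_NormedModule) f 0 1) as [M HM].
{ intros t _; apply Hf. }
assert (HM' : forall t, 0 <= t <= 1 -> Cmod (f t) <= M).
{ intros t Ht; rewrite Cmod_norm; apply Rlt_le, HM, Ht. }
assert (HM0 : 0 <= M) by (apply Rle_trans with (2 := HM' 0 ltac:(lra)), Cmod_ge_0).
apply is_RInt01_iff; [intros; apply Hex|]; intros eps Heps.
exists (eps / (4 * (M + 1))); split; [apply Rdiv_lt_0_compat; lra|].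
set (d := eps / (4 * (M + 1))); intros u v Hu Hu1 Hv Hv0.
assert (Hd : d * (M + 1) = eps / 4) by (unfold d; field; lra).
assert (B1 : Cmod (CRInt f 0 u) <= (u - 0) * M).
{ apply Cmod_CRInt_le; [lra| |apply Hex]; intros t Ht; apply HM'; lra. }
assert (B2 : Cmod (CRInt f v 1) <= (1 - v) * M).
{ apply Cmod_CRInt_le; [lra| |apply Hex]; intros t Ht; apply HM'; lra. }
rewrite <- (CRInt_Chasles f 0 u 1), <- (CRInt_Chasles f u v 1) by apply Hex.
replace (CRInt f u v - (CRInt f 0 u + (CRInt f u v + CRInt f v 1)))%C
  with (- (CRInt f 0 u + CRInt f v 1))%C by ring.
rewrite Cmod_opp; apply Rle_lt_trans with (1 := Cmod_triangle _ _); nra.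
Qed.

Lemma is_RInt01_seg_fun (g : C -> C) (a b : C) :
  (forall u : C, continuous g u) -> is_RInt01 (seg_fun g a b) (segI g a b).
Proof. intros Hg; apply is_RInt01_continuous; intros t; apply continuous_seg_fun, Hg. Qed.

Lemma is_RInt01_quotient (K g : C -> C) (z : C) :
  (forall u : C, continuous g u) -> (forall u, u <> RtoC 0 -> g u = K u / u)%C ->
  is_RInt01 (seg_fun (fun u => K u / u)%C (RtoC 0) z) (segI g (RtoC 0) z).
Proof.
intros Hg E; apply is_RInt01_ext with (2 := is_RInt01_seg_fun g (RtoC 0) z Hg).
intros t Ht; unfold seg_fun.
(* For [z = 0] the factor b - a of [seg_fun] is 0 and absorbs the quotient by 0; otherwise the open
   segment avoids 0. *)
destruct (Ceq_dec z (RtoC 0)) as [->|Hz]; [ring|].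
rewrite E; [reflexivity|].
replace (0 + RtoC t * (z - 0))%C with (RtoC t * z)%C by ring.
apply Cmult_neq_0; [intros E0; apply RtoC_inj in E0; lra|exact Hz].
Qed.

Lemma H0_integral_quotient (K K1 : C -> C) (c : C) :
  H0 K ->
  (forall z, K1 z = c * seg_int (fun u => K u / u) (RtoC 0) z)%C ->
  (forall z, ex_seg_int (fun u => K u / u)%C (RtoC 0) z) /\ H0 K1.
Proof.
intros HK E.
destruct (H0_factor K HK) as (g & _ & Eg & Cg & Dg).
assert (I := fun z => is_RInt01_quotient K g z Cg Eg).
assert (E1 : forall z, K1 z = (c * segI g (RtoC 0) z)%C).
{ intros z; rewrite E; f_equal; apply RInt01_unique, I. }
split; [intros z; exists (segI g (RtoC 0) z); apply I|split].
(* The case c = 0 is separate because the general one passes to [eps / Cmod c]. *)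
- intros z; destruct (Ceq_dec c (RtoC 0)) as [Hc|Hc]; exists (c * g z)%C; apply is_derive_C_iff;
    intros eps Heps.
  + exists 1; split; [lra|]; intros y _; rewrite !E1, Hc.
    replace (0 * segI g 0 y - 0 * segI g 0 z - (y - z) * (0 * g z))%C with (RtoC 0) by ring.
    rewrite Cmod_0; pose proof (Cmod_ge_0 (y - z)); nra.
  + assert (Hcp : 0 < Cmod c) by (apply Cmod_gt_0; exact Hc).
    destruct (proj1 (is_derive_C_iff _ _ _) (primitive_from_0 g z Cg Dg) (eps / Cmod c))
      as (d & Hd & H); [apply Rdiv_lt_0_compat; lra|].
    exists d; split; [exact Hd|]; intros y Hy; rewrite !E1.
    replace (c * segI g 0 y - c * segI g 0 z - (y - z) * (c * g z))%C
      with (c * (segI g 0 y - segI g 0 z - (y - z) * g z))%C by ring.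
    rewrite Cmod_mult.
    replace (eps * Cmod (y - z)) with (Cmod c * (eps / Cmod c * Cmod (y - z)))
      by (field; lra).
    apply Rmult_le_compat_l; [lra|apply H, Hy].
- rewrite E1, segI_refl; ring.
Qed.

(** * The two branches of the inverse of [tauf] *)

Lemma rpow_pos (t a : R) : 0 < t -> rpow t a = Rpower t a.
Proof. intros Ht; unfold rpow; destruct (Rlt_dec 0 t); [reflexivity|contradiction]. Qed.

Lemma rpow_nonpos (t a : R) : t <= 0 -> rpow t a = 0.
Proof. intros Ht; unfold rpow; destruct (Rlt_dec 0 t); [lra|reflexivity]. Qed.

Lemma rpow_ge_0 (t a : R) : 0 <= rpow t a.
Proof.
destruct (Rlt_dec 0 t) as [H|H].
- rewrite rpow_pos by exact H; apply Rlt_le, exp_pos.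
- rewrite rpow_nonpos by lra; apply Rle_refl.
Qed.

Lemma rpow_le_1 (t a : R) : 0 < a -> t <= 1 -> rpow t a <= 1.
Proof.
intros Ha Ht; destruct (Rlt_dec 0 t) as [H|H].
- rewrite rpow_pos by exact H.
  rewrite <- (Rpower_1 1) by lra.
  apply Rle_trans with (Rpower 1 a); [apply Rle_Rpower_l; lra|].
  unfold Rpower; rewrite ln_1, !Rmult_0_r; apply Rle_refl.
- rewrite rpow_nonpos by lra; lra.
Qed.

Lemma Rpower_minus_1 (t a : R) : 0 < t -> Rpower t (a - 1) = Rpower t a / t.
Proof.
intros Ht; unfold Rminus; rewrite Rpower_plus, Rpower_Ropp, Rpower_1 by exact Ht.
reflexivity.
Qed.

Lemma is_derive_rpow (t a : R) :
  0 < t -> is_derive (fun t => rpow t a) t (a * Rpower t (a - 1)).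
Proof.
intros Ht; apply is_derive_ext_loc with (fun t => Rpower t a).
- exists (mkposreal t Ht); intros y Hy.
  change (Rabs (y - t) < t) in Hy; apply Rabs_def2 in Hy.
  rewrite rpow_pos by lra; reflexivity.
- apply is_derive_Reals, derivable_pt_lim_power; exact Ht.
Qed.

Lemma continuous_rpow (t a : R) : 0 < a -> continuous (fun t => rpow t a) t.
Proof.
intros Ha; destruct (Rtotal_order t 0) as [Ht|[->|Ht]].
- apply continuous_ext_loc with (fun _ => 0); [|apply continuous_const].
  assert (Hp : 0 < - t) by lra; exists (mkposreal _ Hp); intros y Hy.
  change (Rabs (y - t) < - t) in Hy; apply Rabs_def2 in Hy.
  rewrite rpow_nonpos by lra; reflexivity.
- apply filterlim_locally; intros eps.
  assert (Hp : 0 < Rpower eps (/ a)) by apply exp_pos.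
  exists (mkposreal _ Hp); intros y Hy.
  change (Rabs (y - 0) < Rpower eps (/ a)) in Hy.
  change (Rabs (rpow y a - rpow 0 a) < eps).
  rewrite (rpow_nonpos 0), Rminus_0_r, Rabs_pos_eq by (lra || apply rpow_ge_0).
  destruct (Rlt_dec 0 y) as [H|H].
  + rewrite rpow_pos by exact H.
    rewrite Rminus_0_r, Rabs_pos_eq in Hy by lra.
    apply Rlt_le_trans with (Rpower (Rpower eps (/ a)) a).
    * apply Rlt_Rpower_l; lra.
    * rewrite Rpower_mult, Rinv_l, Rpower_1 by (lra || apply cond_pos); apply Rle_refl.
  + rewrite rpow_nonpos by lra; apply cond_pos.
- apply (ex_derive_continuous (V := R_NormedModule)).
  exists (a * Rpower t (a - 1)); apply is_derive_rpow, Ht.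
Qed.

Definition dtau (nu t : R) : R := Rpower t (- nu - 1) * (- nu + (nu - 1) * t).

Lemma is_derive_tauf (nu t : R) : 0 < t -> is_derive (tauf nu) t (dtau nu t).
Proof.
intros Ht; unfold tauf.
replace (dtau nu t) with
  (plus (mult (- nu * Rpower t (- nu - 1)) (1 - t)) (mult (rpow t (- nu)) (0 - 1))).
- apply (is_derive_mult (K := R_AbsRing) (fun t => rpow t (- nu)) (fun t => 1 - t)).
  + apply is_derive_rpow, Ht.
  + auto_derive; [exact I|ring].
  + intros; apply Rmult_comm.
- unfold dtau, plus, mult; simpl; rewrite rpow_pos by exact Ht.
  rewrite Rpower_minus_1 by exact Ht; field; lra.
Qed.

Lemma continuous_tauf (nu t : R) : nu < 0 -> continuous (tauf nu) t.
Proof.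
intros Hnu; apply (continuous_mult (K := R_AbsRing)).
- apply continuous_rpow; lra.
- apply (continuous_minus (V := R_NormedModule));
    [apply continuous_const|apply continuous_id].
Qed.

Lemma continuous_dtau (nu t : R) : 0 < t -> continuous (dtau nu) t.
Proof.
intros Ht; apply (ex_derive_continuous (V := R_NormedModule)).
unfold dtau, Rpower; auto_derive; exact Ht.
Qed.

Lemma that_bounds (nu : R) : nu < 0 -> 0 < that nu < 1.
Proof.
intros Hnu; unfold that.
replace (nu / (nu - 1)) with (- nu / (1 - nu)) by (field; lra).
split; [apply Rdiv_lt_0_compat; lra|].
apply Rmult_lt_reg_r with (1 - nu); [lra|].
unfold Rdiv; rewrite Rmult_assoc, Rinv_l; lra.
Qed.

(** In this form the sign of the derivative, hence the monotonicity of [tauf] on either side of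
    [that nu], can be read off. *)
Lemma dtau_factor (nu t : R) :
  nu < 0 -> dtau nu t = Rpower t (- nu - 1) * ((1 - nu) * (that nu - t)).
Proof. intros Hnu; unfold dtau, that; f_equal; field; lra. Qed.

Lemma tauf_0 (nu : R) : tauf nu 0 = 0.
Proof. unfold tauf; rewrite rpow_nonpos; lra. Qed.

Lemma tauf_1 (nu : R) : tauf nu 1 = 0.
Proof. unfold tauf; ring. Qed.

Lemma tauf_pos (nu t : R) : 0 < t < 1 -> 0 < tauf nu t.
Proof.
intros Ht; unfold tauf; rewrite rpow_pos by lra.
apply Rmult_lt_0_compat; [apply exp_pos|lra].
Qed.

Lemma tauf_MVT (nu s t : R) :
  0 < s -> s < t -> exists c, tauf nu t - tauf nu s = dtau nu c * (t - s) /\ s < c < t.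
Proof.
intros Hs Hst; apply (MVT_cor2 (tauf nu) (dtau nu)); [exact Hst|].
intros c Hc; apply is_derive_Reals, is_derive_tauf; lra.
Qed.

Lemma tauf_increasing (nu s t : R) :
  nu < 0 -> 0 <= s -> s < t -> t <= that nu -> tauf nu s < tauf nu t.
Proof.
intros Hnu Hs Hst Ht; pose proof (that_bounds nu Hnu).
(* The mean value theorem is used only from a positive [s], as the derivative is unbounded near 0
   when -1 < nu; for [s = 0] positivity of [tauf] suffices. *)
destruct Hs as [Hs|<-].
- destruct (tauf_MVT nu s t Hs Hst) as (c & E & Hc).
  assert (0 < dtau nu c).
  { rewrite dtau_factor by exact Hnu; apply Rmult_lt_0_compat; [apply exp_pos|nra]. }
  nra.
- rewrite tauf_0; apply tauf_pos; lra.
Qed.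

Lemma tauf_decreasing (nu s t : R) :
  nu < 0 -> that nu <= s -> s < t -> tauf nu t < tauf nu s.
Proof.
intros Hnu Hs Hst; pose proof (that_bounds nu Hnu).
destruct (tauf_MVT nu s t ltac:(lra) Hst) as (c & E & Hc).
assert (dtau nu c < 0).
{ rewrite dtau_factor by exact Hnu.
  assert (0 < Rpower c (- nu - 1)) by apply exp_pos.
  assert (0 < (1 - nu) * (c - that nu)) by nra; nra. }
nra.
Qed.

Lemma tauhat_pos (nu : R) : nu < 0 -> 0 < tauhat nu.
Proof. intros Hnu; apply tauf_pos, that_bounds, Hnu. Qed.

Lemma continuity_tauf (nu : R) : nu < 0 -> continuity (tauf nu).
Proof. intros Hnu t; apply continuity_pt_filterlim, continuous_tauf, Hnu. Qed.

(** The description by [iota] is meaningful because the intermediate value theorem gives existence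
    and strict monotonicity uniqueness. *)
Lemma theta_minus_spec (nu tau : R) :
  nu < 0 -> 0 <= tau <= tauhat nu ->
  0 <= theta_minus nu tau <= that nu /\ tauf nu (theta_minus nu tau) = tau.
Proof.
intros Hnu Ht; pose proof (that_bounds nu Hnu).
apply (iota_correct (fun t : R => 0 <= t <= that nu /\ tauf nu t = tau)).
destruct (IVT_gen (tauf nu) 0 (that nu) tau (continuity_tauf nu Hnu)) as (t & Ht1 & Ht2).
{ fold (tauhat nu); rewrite tauf_0, Rmin_left, Rmax_right by lra; exact Ht. }
rewrite Rmin_left, Rmax_right in Ht1 by lra.
exists t; split; [split; assumption|].
intros s [Hs1 Hs2]; destruct (Rtotal_order t s) as [L|[E|L]]; [|exact E|].
- pose proof (tauf_increasing nu t s Hnu ltac:(lra) L ltac:(lra)); lra.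
- pose proof (tauf_increasing nu s t Hnu ltac:(lra) L ltac:(lra)); lra.
Qed.

Lemma theta_plus_spec (nu tau : R) :
  nu < 0 -> 0 <= tau <= tauhat nu ->
  that nu <= theta_plus nu tau <= 1 /\ tauf nu (theta_plus nu tau) = tau.
Proof.
intros Hnu Ht; pose proof (that_bounds nu Hnu).
apply (iota_correct (fun t : R => that nu <= t <= 1 /\ tauf nu t = tau)).
destruct (IVT_gen (tauf nu) (that nu) 1 tau (continuity_tauf nu Hnu)) as (t & Ht1 & Ht2).
{ fold (tauhat nu); rewrite tauf_1, Rmin_right, Rmax_left by lra; exact Ht. }
rewrite Rmin_left, Rmax_right in Ht1 by lra.
exists t; split; [split; assumption|].
intros s [Hs1 Hs2]; destruct (Rtotal_order t s) as [L|[E|L]]; [|exact E|].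
- pose proof (tauf_decreasing nu t s Hnu ltac:(lra) L); lra.
- pose proof (tauf_decreasing nu s t Hnu ltac:(lra) L); lra.
Qed.

(** This and the next three lemmas reduce inequalities for the inverses to values of [tauf]. No
    upper bound on [t] appears here: the contrary assumption [t <= theta_minus nu tau] already
    places [t] on the increasing side. *)
Lemma theta_minus_lt (nu tau t : R) :
  nu < 0 -> 0 <= tau <= tauhat nu -> 0 <= t -> tau < tauf nu t -> theta_minus nu tau < t.
Proof.
intros Hnu Ht H0 Hlt; destruct (theta_minus_spec nu tau Hnu Ht) as [H1 H2].
destruct (Rlt_dec (theta_minus nu tau) t) as [L|L]; [exact L|exfalso].
destruct (Rle_lt_or_eq_dec t (theta_minus nu tau) (Rnot_lt_le _ _ L)) as [L'|E];
  [|rewrite E in *; lra].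
pose proof (tauf_increasing nu t (theta_minus nu tau) Hnu H0 L' ltac:(lra)); lra.
Qed.

Lemma theta_minus_gt (nu tau t : R) :
  nu < 0 -> 0 <= tau <= tauhat nu -> t <= that nu -> tauf nu t < tau -> t < theta_minus nu tau.
Proof.
intros Hnu Ht H0 Hlt; destruct (theta_minus_spec nu tau Hnu Ht) as [H1 H2].
destruct (Rlt_dec t (theta_minus nu tau)) as [L|L]; [exact L|exfalso].
destruct (Rle_lt_or_eq_dec (theta_minus nu tau) t (Rnot_lt_le _ _ L)) as [L'|E];
  [|rewrite E in *; lra].
pose proof (tauf_increasing nu (theta_minus nu tau) t Hnu ltac:(lra) L' ltac:(lra)); lra.
Qed.

Lemma theta_plus_gt (nu tau t : R) :
  nu < 0 -> 0 <= tau <= tauhat nu -> tau < tauf nu t -> t < theta_plus nu tau.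
Proof.
intros Hnu Ht Hlt; destruct (theta_plus_spec nu tau Hnu Ht) as [H1 H2].
destruct (Rlt_dec t (theta_plus nu tau)) as [L|L]; [exact L|exfalso].
destruct (Rle_lt_or_eq_dec (theta_plus nu tau) t (Rnot_lt_le _ _ L)) as [L'|E];
  [|rewrite E in *; lra].
pose proof (tauf_decreasing nu (theta_plus nu tau) t Hnu ltac:(lra) L'); lra.
Qed.

Lemma theta_plus_lt (nu tau t : R) :
  nu < 0 -> 0 <= tau <= tauhat nu -> that nu <= t -> tauf nu t < tau -> theta_plus nu tau < t.
Proof.
intros Hnu Ht H0 Hlt; destruct (theta_plus_spec nu tau Hnu Ht) as [H1 H2].
destruct (Rlt_dec (theta_plus nu tau) t) as [L|L]; [exact L|exfalso].
destruct (Rle_lt_or_eq_dec t (theta_plus nu tau) (Rnot_lt_le _ _ L)) as [L'|E];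
  [|rewrite E in *; lra].
pose proof (tauf_decreasing nu t (theta_plus nu tau) Hnu ltac:(lra) L'); lra.
Qed.

(** The common interface of the two inverses, so that the substitution is proved once. The interval
    is open because the derivative of [tauf] vanishes at [that nu] and may be infinite at 0. *)
Record tau_branch (nu : R) (theta : R -> R) (lo hi : R) : Prop := {
  branch_lo : 0 <= lo;
  branch_hi : hi <= 1;
  branch_theta : forall tau, 0 < tau < tauhat nu -> lo < theta tau < hi;
  branch_tauf_theta : forall tau, 0 < tau < tauhat nu -> tauf nu (theta tau) = tau;
  branch_theta_tauf : forall t, lo < t < hi -> theta (tauf nu t) = t;
  branch_tauf : forall t, lo < t < hi -> 0 < tauf nu t < tauhat nu;
  branch_dtau : forall t, lo < t < hi -> dtau nu t <> 0;
  branch_continuous : forall tau, 0 < tau < tauhat nu -> continuous theta tau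
}.

(** Continuity from order alone, suited to inverses of monotone functions: each bound on [theta]
    becomes a bound on its argument. *)
Lemma continuous_of_bracket (f : R -> R) (x lo hi : R) :
  lo < f x < hi ->
  (forall a, lo < a < f x -> locally x (fun y => a < f y)) ->
  (forall b, f x < b < hi -> locally x (fun y => f y < b)) -> continuous f x.
Proof.
intros Hx Ha Hb; apply filterlim_locally; intros eps.
pose proof (cond_pos eps).
(* The midpoint keeps the bracket inside [lo], [hi] when [eps] is large. *)
assert (La := Ha (Rmax (f x - eps) ((lo + f x) / 2))
  ltac:(split; [apply Rlt_le_trans with (2 := Rmax_r _ _)|apply Rmax_lub_lt]; lra)).
assert (Lb := Hb (Rmin (f x + eps) ((f x + hi) / 2))
  ltac:(split; [apply Rmin_glb_lt|apply Rle_lt_trans with (1 := Rmin_r _ _)]; lra)).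
generalize (filter_and _ _ La Lb); apply filter_imp; intros y [H1 H2].
pose proof (Rmax_l (f x - eps) ((lo + f x) / 2)).
pose proof (Rmin_l (f x + eps) ((f x + hi) / 2)).
apply Rabs_def1; unfold minus, plus, opp; simpl; lra.
Qed.

Lemma locally_between (a b x : R) : a < x < b -> locally x (fun y => a < y < b).
Proof.
intros Hx; assert (Hp : 0 < Rmin (x - a) (b - x)) by (apply Rmin_pos; lra).
exists (mkposreal _ Hp); intros y Hy.
change (Rabs (y - x) < Rmin (x - a) (b - x)) in Hy; apply Rabs_def2 in Hy.
pose proof (Rmin_l (x - a) (b - x)); pose proof (Rmin_r (x - a) (b - x)); lra.
Qed.

Lemma tauf_lt_tauhat (nu t : R) :
  nu < 0 -> 0 <= t -> t <> that nu -> tauf nu t < tauhat nu.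
Proof.
intros Hnu Ht Hn; unfold tauhat; destruct (Rdichotomy _ _ Hn).
- apply tauf_increasing; lra.
- apply tauf_decreasing; lra.
Qed.

Lemma theta_minus_branch (nu : R) :
  nu < 0 -> tau_branch nu (theta_minus nu) 0 (that nu).
Proof.
intros Hnu; pose proof (that_bounds nu Hnu).
assert (H1 : forall tau, 0 < tau < tauhat nu -> 0 < theta_minus nu tau < that nu).
{ intros tau Ht; split.
  - apply theta_minus_gt; try lra; rewrite tauf_0; lra.
  - apply theta_minus_lt; try lra; fold (tauhat nu); lra. }
assert (H2 : forall tau, 0 < tau < tauhat nu -> tauf nu (theta_minus nu tau) = tau)
  by (intros tau Ht; apply theta_minus_spec; lra).
assert (H3 : forall t, 0 < t < that nu -> 0 < tauf nu t < tauhat nu).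
{ intros t Ht; split; [apply tauf_pos|apply tauf_lt_tauhat]; lra. }
constructor; try lra; try assumption.
- intros t Ht; specialize (H3 t Ht).
  destruct (Rtotal_order (theta_minus nu (tauf nu t)) t) as [L|[E|L]]; [|exact E|].
  + pose proof (tauf_increasing nu (theta_minus nu (tauf nu t)) t Hnu ltac:(apply Rlt_le, H1, H3) L ltac:(lra)) as X.
    rewrite H2 in X by exact H3; lra.
  + pose proof (tauf_increasing nu t (theta_minus nu (tauf nu t)) Hnu ltac:(lra) L ltac:(apply Rlt_le, H1, H3)) as X.
    rewrite H2 in X by exact H3; lra.
- intros t Ht; rewrite dtau_factor by exact Hnu; apply Rgt_not_eq, Rmult_lt_0_compat;
    [apply exp_pos|nra].
- intros tau Ht; pose proof (H1 tau Ht); apply continuous_of_bracket with 0 (that nu);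
    [apply H1, Ht| |].
  + intros a Ha; pose proof (tauf_increasing nu a (theta_minus nu tau) Hnu ltac:(lra) (proj2 Ha) ltac:(lra)) as X.
    rewrite H2 in X by exact Ht; specialize (H3 a ltac:(lra)).
    generalize (locally_between (tauf nu a) (tauhat nu) tau ltac:(lra)); apply filter_imp.
    intros y Hy; apply theta_minus_gt; lra.
  + intros b Hb; pose proof (tauf_increasing nu (theta_minus nu tau) b Hnu ltac:(lra) (proj1 Hb) ltac:(lra)) as X.
    rewrite H2 in X by exact Ht; specialize (H3 b ltac:(lra)).
    generalize (locally_between 0 (tauf nu b) tau ltac:(lra)); apply filter_imp.
    intros y Hy; apply theta_minus_lt; lra.
Qed.

Lemma theta_plus_branch (nu : R) :
  nu < 0 -> tau_branch nu (theta_plus nu) (that nu) 1.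
Proof.
intros Hnu; pose proof (that_bounds nu Hnu).
assert (H1 : forall tau, 0 < tau < tauhat nu -> that nu < theta_plus nu tau < 1).
{ intros tau Ht; split.
  - apply theta_plus_gt; try lra; fold (tauhat nu); lra.
  - apply theta_plus_lt; try lra; rewrite tauf_1; lra. }
assert (H2 : forall tau, 0 < tau < tauhat nu -> tauf nu (theta_plus nu tau) = tau)
  by (intros tau Ht; apply theta_plus_spec; lra).
assert (H3 : forall t, that nu < t < 1 -> 0 < tauf nu t < tauhat nu).
{ intros t Ht; split; [apply tauf_pos|apply tauf_lt_tauhat]; lra. }
constructor; try lra; try assumption.
- intros t Ht; specialize (H3 t Ht).
  destruct (Rtotal_order (theta_plus nu (tauf nu t)) t) as [L|[E|L]]; [|exact E|].
  + pose proof (tauf_decreasing nu (theta_plus nu (tauf nu t)) t Hnu ltac:(apply Rlt_le, H1, H3) L) as X.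
    rewrite H2 in X by exact H3; lra.
  + pose proof (tauf_decreasing nu t (theta_plus nu (tauf nu t)) Hnu ltac:(lra) L) as X.
    rewrite H2 in X by exact H3; lra.
- intros t Ht; rewrite dtau_factor by exact Hnu; apply Rlt_not_eq.
  assert (0 < Rpower t (- nu - 1)) by apply exp_pos.
  assert (0 < (1 - nu) * (t - that nu)) by nra; nra.
- intros tau Ht; pose proof (H1 tau Ht); apply continuous_of_bracket with (that nu) 1;
    [apply H1, Ht| |].
  + intros a Ha; pose proof (tauf_decreasing nu a (theta_plus nu tau) Hnu ltac:(lra) (proj2 Ha)) as X.
    rewrite H2 in X by exact Ht; specialize (H3 a ltac:(lra)).
    generalize (locally_between 0 (tauf nu a) tau ltac:(lra)); apply filter_imp.
    intros y Hy; apply theta_plus_gt; lra.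
  + intros b Hb; pose proof (tauf_decreasing nu (theta_plus nu tau) b Hnu ltac:(lra) (proj1 Hb)) as X.
    rewrite H2 in X by exact Ht; specialize (H3 b ltac:(lra)).
    generalize (locally_between (tauf nu b) (tauhat nu) tau ltac:(lra)); apply filter_imp.
    intros y Hy; apply theta_plus_lt; lra.
Qed.

(** * Change of variables along the two branches *)

(** This is h(t) dt/ds for t = theta(s tauhat), where [s] is the parameter of the segment in
    [seg_fun]. On the upper branch dt/ds is negative. *)
Definition pullback (nu : R) (theta : R -> R) (h : R -> C) (s : R) : C :=
  (RtoC (tauhat nu / dtau nu (theta (s * tauhat nu)%R)) * h (theta (s * tauhat nu)%R))%C.

Lemma scaled_tau_range (nu s : R) :
  nu < 0 -> 0 < s < 1 -> 0 < s * tauhat nu < tauhat nu.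
Proof. intros Hnu Hs; pose proof (tauhat_pos nu Hnu); nra. Qed.

Lemma continuous_pullback (nu : R) (theta : R -> R) (lo hi : R) (h : R -> C) (s : R) :
  nu < 0 -> tau_branch nu theta lo hi -> (forall t, 0 < t < 1 -> continuous h t) ->
  0 < s < 1 -> continuous (pullback nu theta h) s.
Proof.
intros Hnu B Hh Hs; pose proof (scaled_tau_range nu s Hnu Hs) as Hr.
pose proof (branch_theta _ _ _ _ B _ Hr) as Ht.
pose proof (branch_lo _ _ _ _ B); pose proof (branch_hi _ _ _ _ B).
apply (continuous_comp (fun s => theta (s * tauhat nu))
  (fun t => RtoC (tauhat nu / dtau nu t) * h t)%C).
- apply (continuous_comp (fun s => s * tauhat nu) theta).
  + apply (continuous_mult (K := R_AbsRing) (fun s => s) (fun _ => tauhat nu));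
      [apply continuous_id|apply continuous_const].
  + apply (branch_continuous _ _ _ _ B), Hr.
- apply continuous_Cmult; [|apply Hh; lra].
  apply continuous_RtoC.
  apply (continuous_mult (K := R_AbsRing) (fun _ => tauhat nu) (fun t => / dtau nu t));
    [apply continuous_const|].
  apply (continuous_comp (dtau nu) Rinv); [apply continuous_dtau; lra|].
  apply continuous_Rinv, (branch_dtau _ _ _ _ B), Ht.
Qed.

Lemma ex_RInt_pullback (nu : R) (theta : R -> R) (lo hi : R) (h : R -> C) (p q : R) :
  nu < 0 -> tau_branch nu theta lo hi -> (forall t, 0 < t < 1 -> continuous h t) ->
  0 < p < 1 -> 0 < q < 1 -> CexRInt (pullback nu theta h) p q.
Proof.
intros Hnu B Hh Hp Hq; apply CexRInt_continuous; intros t Ht.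
apply (continuous_pullback nu theta lo hi); [assumption..|].
unfold Rmin, Rmax in Ht; destruct (Rle_dec p q); lra.
Qed.

(** The substitution is made in the direction s = tauf t / tauhat, so that [tauf] is differentiated
    and the inverse need only be continuous. Oriented integrals cover the decreasing branch without
    change. *)
Lemma RInt_pullback (nu : R) (theta : R -> R) (lo hi : R) (h : R -> C) (p q : R) :
  nu < 0 -> tau_branch nu theta lo hi -> (forall t, 0 < t < 1 -> continuous h t) ->
  0 < p < 1 -> 0 < q < 1 ->
  CRInt (pullback nu theta h) p q =
  CRInt h (theta (p * tauhat nu)) (theta (q * tauhat nu)).
Proof.
intros Hnu B Hh Hp Hq.
pose proof (scaled_tau_range nu p Hnu Hp) as Hrp.
pose proof (scaled_tau_range nu q Hnu Hq) as Hrq.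
pose proof (branch_theta _ _ _ _ B _ Hrp) as Hp'.
pose proof (branch_theta _ _ _ _ B _ Hrq) as Hq'.
pose proof (branch_lo _ _ _ _ B); pose proof (branch_hi _ _ _ _ B).
pose proof (tauhat_pos nu Hnu) as HT.
set (a := theta (p * tauhat nu)) in *; set (b := theta (q * tauhat nu)) in *.
assert (Hab : forall t, Rmin a b <= t <= Rmax a b -> lo < t < hi).
{ intros t Ht; unfold Rmin, Rmax in Ht; destruct (Rle_dec a b); lra. }
pose proof (RInt_comp (V := C_R_CompleteNormedModule) (pullback nu theta h)
  (fun t => tauf nu t / tauhat nu) (fun t => dtau nu t / tauhat nu) a b) as E.
assert (Ea : tauf nu a = p * tauhat nu) by apply (branch_tauf_theta _ _ _ _ B _ Hrp).
assert (Eb : tauf nu b = q * tauhat nu) by apply (branch_tauf_theta _ _ _ _ B _ Hrq).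
cbv beta in E; rewrite Ea, Eb in E.
replace (p * tauhat nu / tauhat nu) with p in E by (field; lra).
replace (q * tauhat nu / tauhat nu) with q in E by (field; lra).
rewrite <- E.
- apply CRInt_ext; intros t Ht.
  assert (Htt : lo < t < hi) by (apply Hab; lra).
  transitivity (RtoC (dtau nu t / tauhat nu) * pullback nu theta h (tauf nu t / tauhat nu))%C.
  { exact (scal_R_Cmult _ _). }
  unfold pullback.
  replace (tauf nu t / tauhat nu * tauhat nu) with (tauf nu t) by (field; lra).
  rewrite (branch_theta_tauf _ _ _ _ B) by exact Htt.
  rewrite Cmult_assoc, <- RtoC_mult.
  replace (dtau nu t / tauhat nu * (tauhat nu / dtau nu t)) with 1
    by (field; split; [apply (branch_dtau _ _ _ _ B), Htt|lra]).
  ring.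
- intros t Ht; apply Hab in Ht; pose proof (branch_tauf _ _ _ _ B t Ht).
  apply (continuous_pullback nu theta lo hi); [assumption..|].
  split; [apply Rdiv_lt_0_compat; lra|].
  apply Rmult_lt_reg_r with (tauhat nu); [exact HT|].
  unfold Rdiv; rewrite Rmult_assoc, Rinv_l; lra.
- intros t Ht; apply Hab in Ht; split.
  + unfold Rdiv; apply (is_derive_ext (fun t => scal (/ tauhat nu) (tauf nu t)));
      [intros; apply Rmult_comm|].
    rewrite Rmult_comm; apply (is_derive_scal (tauf nu)); apply is_derive_tauf; lra.
  + apply (continuous_mult (K := R_AbsRing) (dtau nu) (fun _ => / tauhat nu));
      [apply continuous_dtau; lra|apply continuous_const].
Qed.

Lemma is_RInt01_pullback (nu : R) (h : R -> C) (l : C) :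
  nu < 0 -> (forall t, 0 < t < 1 -> continuous h t) -> is_RInt01 h l ->
  is_RInt01 (fun s => pullback nu (theta_minus nu) h s - pullback nu (theta_plus nu) h s)%C l.
Proof.
intros Hnu Hh Hl.
pose proof (that_bounds nu Hnu) as Hth; pose proof (tauhat_pos nu Hnu) as HT.
pose proof (theta_minus_branch nu Hnu) as Bm; pose proof (theta_plus_branch nu Hnu) as Bp.
assert (Hex : forall u v, 0 < u < 1 -> 0 < v < 1 -> CexRInt h u v).
{ intros u v Hu Hv; apply CexRInt_continuous; intros t Ht; apply Hh.
  unfold Rmin, Rmax in Ht; destruct (Rle_dec u v); lra. }
assert (Em := fun p q => ex_RInt_pullback nu _ _ _ h p q Hnu Bm Hh).
assert (Ep := fun p q => ex_RInt_pullback nu _ _ _ h p q Hnu Bp Hh).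
apply is_RInt01_iff.
{ intros u v Hu Hv.
  apply (ex_RInt_minus (V := C_R_NormedModule)); [apply Em|apply Ep]; assumption. }
intros eps Heps.
destruct (proj1 (is_RInt01_iff h l Hex) Hl (eps / 2)) as (d & Hd & H); [lra|].
destruct (proj1 (continuous_RC_iff h (that nu)) (Hh _ Hth) 1 Rlt_0_1) as (d1 & Hd1 & H1).
set (M := Cmod (h (that nu)) + 1).
assert (HM : 0 < M) by (pose proof (Cmod_ge_0 (h (that nu))); unfold M; lra).
(* Half-width of the gap around [that nu]: there [M] bounds [h], the integral is at most 2 r M <=
   eps / 4, and the gap stays inside the unit interval. *)
set (r := Rmin (Rmin (d1 / 2) (eps / (8 * M))) (Rmin (that nu / 2) ((1 - that nu) / 2))).
assert (Hr : 0 < r).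
{ unfold r; repeat apply Rmin_pos; try lra; apply Rdiv_lt_0_compat; lra. }
assert (Hr1 : r <= d1 / 2) by (unfold r; apply Rle_trans with (1 := Rmin_l _ _), Rmin_l).
assert (Hr2 : r * (8 * M) <= eps).
{ replace eps with (eps / (8 * M) * (8 * M)) by (field; lra).
  apply Rmult_le_compat_r; [lra|]; unfold r.
  apply Rle_trans with (1 := Rmin_l _ _), Rmin_r. }
assert (Hr3 : r <= that nu / 2) by (unfold r; apply Rle_trans with (1 := Rmin_r _ _), Rmin_l).
assert (Hr4 : r <= (1 - that nu) / 2) by (unfold r; apply Rle_trans with (1 := Rmin_r _ _), Rmin_r).
set (t1 := Rmin (d / 2) (that nu / 2)); set (t2 := 1 - Rmin (d / 2) ((1 - that nu) / 2)).
assert (Ht1 : 0 < t1 < d /\ t1 < that nu).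
{ unfold t1; pose proof (Rmin_l (d / 2) (that nu / 2)); pose proof (Rmin_r (d / 2) (that nu / 2)).
  assert (0 < Rmin (d / 2) (that nu / 2)) by (apply Rmin_pos; lra); lra. }
assert (Ht2 : 1 - d < t2 < 1 /\ that nu < t2).
{ unfold t2; pose proof (Rmin_l (d / 2) ((1 - that nu) / 2)); pose proof (Rmin_r (d / 2) ((1 - that nu) / 2)).
  assert (0 < Rmin (d / 2) ((1 - that nu) / 2)) by (apply Rmin_pos; lra); lra. }
set (T := tauhat nu) in *.
assert (P1 := branch_tauf _ _ _ _ Bm t1 ltac:(lra)).
assert (P2 := branch_tauf _ _ _ _ Bp t2 ltac:(lra)).
assert (Q1 := branch_tauf _ _ _ _ Bm (that nu - r) ltac:(lra)).
assert (Q2 := branch_tauf _ _ _ _ Bp (that nu + r) ltac:(lra)).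
fold T in P1, P2, Q1, Q2.
(* [m] carries the conditions over to tau: values below [m] have their inverses outside [t1], [t2],
   and values above T - m have theirs within [r] of [that nu]. *)
set (m := Rmin (Rmin (tauf nu t1) (tauf nu t2)) (Rmin (T - tauf nu (that nu - r)) (T - tauf nu (that nu + r)))).
assert (Hm : 0 < m) by (unfold m; repeat apply Rmin_pos; lra).
assert (Hm1 : m <= tauf nu t1) by (unfold m; apply Rle_trans with (1 := Rmin_l _ _), Rmin_l).
assert (Hm2 : m <= tauf nu t2) by (unfold m; apply Rle_trans with (1 := Rmin_l _ _), Rmin_r).
assert (Hm3 : m <= T - tauf nu (that nu - r)) by (unfold m; apply Rle_trans with (1 := Rmin_r _ _), Rmin_l).
assert (Hm4 : m <= T - tauf nu (that nu + r)) by (unfold m; apply Rle_trans with (1 := Rmin_r _ _), Rmin_r).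
exists (m / T); split; [apply Rdiv_lt_0_compat; assumption|].
intros p q Hp Hp1 Hq Hq0.
assert (Hp' : p * T < m).
{ replace m with (m / T * T) by (field; lra); apply Rmult_lt_compat_r; lra. }
assert (Hq' : T - m < q * T).
{ replace (T - m) with ((1 - m / T) * T) by (field; lra); apply Rmult_lt_compat_r; lra. }
pose proof (scaled_tau_range nu p Hnu ltac:(lra)) as Rp.
pose proof (scaled_tau_range nu q Hnu ltac:(lra)) as Rq.
fold T in Rp, Rq.
rewrite CRInt_minus by ((apply Em || apply Ep); lra).
rewrite (RInt_pullback nu _ _ _ h p q Hnu Bm Hh) by lra.
rewrite (RInt_pullback nu _ _ _ h p q Hnu Bp Hh) by lra.
fold T.
pose proof (branch_theta _ _ _ _ Bm _ Rp) as A1; pose proof (branch_theta _ _ _ _ Bm _ Rq) as A2.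
pose proof (branch_theta _ _ _ _ Bp _ Rp) as A3; pose proof (branch_theta _ _ _ _ Bp _ Rq) as A4.
assert (L1 : theta_minus nu (p * T) < t1) by (apply theta_minus_lt; fold T; lra).
assert (L2 : t2 < theta_plus nu (p * T)) by (apply theta_plus_gt; fold T; lra).
assert (L3 : that nu - r < theta_minus nu (q * T)) by (apply theta_minus_gt; fold T; lra).
assert (L4 : theta_plus nu (q * T) < that nu + r) by (apply theta_plus_lt; fold T; lra).
set (a := theta_minus nu (p * T)) in *; set (b := theta_minus nu (q * T)) in *.
set (a' := theta_plus nu (p * T)) in *; set (b' := theta_plus nu (q * T)) in *.
replace (CRInt h a b - CRInt h a' b' - l)%C with
  ((CRInt h a a' - l) + - CRInt h b b')%C.
2: { rewrite <- (CRInt_Chasles h a b a'), <- (CRInt_Chasles h b a' b') by (apply Hex; lra).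
     ring. }
apply Rle_lt_trans with (1 := Cmod_triangle _ _); rewrite Cmod_opp.
assert (X1 : Cmod (CRInt h a a' - l) < eps / 2) by (apply H; lra).
assert (X2 : Cmod (CRInt h b b') <= (b' - b) * M).
{ apply Cmod_CRInt_le; [lra| |apply Hex; lra].
  intros t Ht; specialize (H1 t ltac:(apply Rabs_def1; lra)).
  pose proof (Cmod_triangle (h t - h (that nu)) (h (that nu))) as Y.
  replace (h t - h (that nu) + h (that nu))%C with (h t) in Y by ring.
  unfold M; lra. }
assert ((b' - b) * M <= 2 * r * M) by (apply Rmult_le_compat_r; lra).
lra.
Qed.

(** * The operator and the Volterra kernel *)

Lemma Cmod_Cexp (w : C) : Cmod (Cexp w) = exp (Re w).
Proof.
unfold Cmod, Cexp; cbn [fst snd].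
replace ((exp (Re w) * cos (Im w)) ^ 2 + (exp (Re w) * sin (Im w)) ^ 2)
  with (exp (Re w) ^ 2 * (Rsqr (sin (Im w)) + Rsqr (cos (Im w)))) by (unfold Rsqr; ring).
rewrite sin2_cos2, Rmult_1_r, sqrt_pow2; [reflexivity|apply Rlt_le, exp_pos].
Qed.

Lemma Cmod_Cexp_le (w : C) (m : R) : Cmod w <= m -> Cmod (Cexp w) <= exp m.
Proof.
intros H; rewrite Cmod_Cexp.
assert (Hle : Re w <= m)
  by apply Rle_trans with (2 := H), Rle_trans with (2 := re_le_Cmod w), Rle_abs.
destruct Hle as [L| ->]; [apply Rlt_le, exp_increasing, L|apply Rle_refl].
Qed.

Lemma continuous_Cexp {U : UniformSpace} (f : U -> C) (t : U) :
  continuous f t -> continuous (fun t => Cexp (f t)) t.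
Proof.
intros Hf.
assert (HR : continuous (fun t => Re (f t)) t)
  by (apply (continuous_comp f fst); [exact Hf|apply continuous_fst]).
assert (HI : continuous (fun t => Im (f t)) t)
  by (apply (continuous_comp f snd); [exact Hf|apply continuous_snd]).
assert (He : continuous (fun t => exp (Re (f t))) t)
  by (apply (continuous_comp (fun t => Re (f t)) exp); [exact HR|apply continuous_exp]).
unfold Cexp; apply continuous_Cpair.
- apply (continuous_mult (K := R_AbsRing) _ (fun t => cos (Im (f t)))); [exact He|].
  apply (continuous_comp (fun t => Im (f t)) cos); [exact HI|apply continuous_cos].
- apply (continuous_mult (K := R_AbsRing) _ (fun t => sin (Im (f t)))); [exact He|].
  apply (continuous_comp (fun t => Im (f t)) sin); [exact HI|apply continuous_sin].
Qed.

(** At t = 0 both sides are 0 by the convention for inverses; holding everywhere, the identity can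
    be passed to [continuous_ext]. *)
Lemma Cinv_RtoC (t : R) : (/ RtoC t)%C = RtoC (/ t).
Proof.
destruct (Req_dec t 0) as [->|Ht]; [|symmetry; apply RtoC_inv, Ht].
rewrite Rinv_0; unfold Cinv, RtoC; cbn [fst snd]; f_equal; unfold Rdiv; ring.
Qed.

(** The exponent shared by [M_fun] and [Psi], with w = z / x. *)
Definition exponent (x : C) (nu : R) (w : C) (t : R) : C :=
  (- w * RtoC (rpow t (- nu)) * (1 - (1 - x) * RtoC t))%C.

Lemma Cmod_exponent_le (x : C) (nu : R) (w : C) (t : R) :
  nu < 0 -> 0 <= t <= 1 ->
  Cmod (exponent x nu w t) <= Cmod w * (1 + Cmod (1 - x)).
Proof.
intros Hnu Ht; unfold exponent; rewrite !Cmod_mult, Cmod_opp, Cmod_R.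
rewrite Rabs_pos_eq by apply rpow_ge_0.
pose proof (Cmod_ge_0 w); pose proof (rpow_ge_0 t (- nu)).
assert (rpow t (- nu) <= 1) by (apply rpow_le_1; lra).
assert (Cmod (1 - (1 - x) * RtoC t) <= 1 + Cmod (1 - x)).
{ apply Rle_trans with (1 := Cmod_triangle _ _).
  rewrite Cmod_opp, Cmod_1, Cmod_mult, Cmod_R, Rabs_pos_eq by lra.
  pose proof (Cmod_ge_0 (1 - x)); nra. }
pose proof (Cmod_ge_0 (1 - (1 - x) * RtoC t)).
apply Rmult_le_compat; try nra.
Qed.

Lemma continuous_M_fun (x : C) (nu : R) (E : C -> C) (z : C) (t : R) :
  nu < 0 -> (forall u : C, continuous E u) -> 0 < t ->
  continuous (M_fun x nu E z) t.
Proof.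
intros Hnu HE Ht; unfold M_fun, Cdiv.
assert (Hr : continuous (fun t => RtoC (rpow t (- nu))) t)
  by (apply continuous_RtoC, continuous_rpow; lra).
assert (Hi : continuous (fun t : R => RtoC t) t) by apply continuous_RtoC, continuous_id.
apply continuous_Cmult.
- apply continuous_Cmult.
  + apply continuous_Cexp, continuous_Cmult.
    * apply continuous_Cmult; [apply continuous_const|exact Hr].
    * apply continuous_Cminus; [apply continuous_const|].
      apply continuous_Cmult; [apply continuous_const|exact Hi].
  + apply (continuous_comp
      (fun t => z * / x * RtoC (rpow t (- nu)) * RtoC (1 - t))%C E); [|apply HE].
    apply continuous_Cmult.
    * apply continuous_Cmult; [apply continuous_const|exact Hr].
    * apply continuous_RtoC, (continuous_minus (V := R_NormedModule));
        [apply continuous_const|apply continuous_id].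
- apply continuous_ext with (fun t => RtoC (/ t));
    [intros; symmetry; apply Cinv_RtoC|].
  apply continuous_RtoC, continuous_Rinv; lra.
Qed.

(** With E(u) = u g(u) and u = w tauf t, the factor u contributes t^(-nu). The exponential is
    bounded, and so is [g] on the segment from 0 to [w], because [tauf] takes values in the unit
    interval. *)
Lemma M_fun_bound (x : C) (nu : R) (E : C -> C) (z : C) :
  nu < 0 -> H0 E -> exists B, 0 <= B /\ forall t, 0 < t < 1 ->
    Cmod (M_fun x nu E z t) <= B * Rpower t (- nu - 1).
Proof.
intros Hnu HE; destruct (H0_factor E HE) as (g & Eg & _ & Cg & _).
set (w := (z / x)%C).
destruct (bounded_continuity (V := C_R_NormedModule) (fun s => g (w * RtoC s)%C) 0 1)
  as [G HG].
{ intros s _.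
  apply (continuous_comp (fun s : R => w * RtoC s)%C g); [|apply Cg].
  apply continuous_Cmult; [apply continuous_const|apply continuous_RtoC, continuous_id]. }
assert (HG' : forall s, 0 <= s <= 1 -> Cmod (g (w * RtoC s)%C) <= G).
{ intros s Hs; rewrite Cmod_norm; apply Rlt_le, HG, Hs. }
assert (HG0 : 0 <= G) by (apply Rle_trans with (2 := HG' 0 ltac:(lra)), Cmod_ge_0).
set (m := exp (Cmod w * (1 + Cmod (1 - x)))).
exists (m * (Cmod w * G)); split.
{ apply Rmult_le_pos; [apply Rlt_le, exp_pos|apply Rmult_le_pos; [apply Cmod_ge_0|exact HG0]]. }
intros t Ht; unfold M_fun; fold w; fold (exponent x nu w t).
assert (Hr : 0 <= rpow t (- nu) <= 1) by (split; [apply rpow_ge_0|apply rpow_le_1; lra]).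
assert (Htn : RtoC t <> RtoC 0) by (intros E0; apply RtoC_inj in E0; lra).
rewrite Cmod_div, Cmod_mult, (Cmod_R t), (Rabs_pos_eq t) by (exact Htn || lra).
rewrite <- (Cmult_assoc w), <- RtoC_mult, Eg, !Cmod_mult, Cmod_R.
rewrite Rpower_minus_1, <- rpow_pos by lra.
set (s := rpow t (- nu) * (1 - t)).
assert (Hs : 0 <= s <= rpow t (- nu)) by (unfold s; nra).
rewrite (Rabs_pos_eq s) by lra.
unfold Rdiv; rewrite <- (Rmult_assoc (m * (Cmod w * G))).
apply Rmult_le_compat_r; [apply Rlt_le, Rinv_0_lt_compat; lra|].
rewrite (Rmult_assoc m); apply Rmult_le_compat.
- apply Cmod_ge_0.
- pose proof (Cmod_ge_0 w); pose proof (Cmod_ge_0 (g (w * RtoC s)%C)).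
  apply Rmult_le_pos; nra.
- apply Cmod_Cexp_le, Cmod_exponent_le; lra.
- specialize (HG' s ltac:(lra)).
  pose proof (Cmod_ge_0 w); pose proof (Cmod_ge_0 (g (w * RtoC s)%C)).
  replace (Cmod w * G * rpow t (- nu)) with ((Cmod w * rpow t (- nu)) * G) by ring.
  apply Rmult_le_compat; nra.
Qed.

Lemma ex_RInt01_M_fun (x : C) (nu : R) (E : C -> C) (z : C) :
  nu < 0 -> H0 E -> exists l, is_RInt01 (M_fun x nu E z) l.
Proof.
intros Hnu HE; destruct (M_fun_bound x nu E z Hnu HE) as (B & HB & HM).
assert (HEc : forall u : C, continuous E u)
  by (intros u; apply differentiable_continuous_C, HE).
assert (Hc : forall t, 0 < t -> continuous (M_fun x nu E z) t)
  by (intros t Ht; apply continuous_M_fun; assumption).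
(* A primitive of the majorant B t^(-nu-1), continuous also at 0 because -nu > 0. *)
apply ex_RInt01_cauchy with (fun t => B / (- nu) * rpow t (- nu)).
- intros t Ht; apply Hc; lra.
- intros u v Hu Huv Hv; rewrite Cmod_norm.
  apply (norm_RInt_le (V := C_R_NormedModule) (M_fun x nu E z)
    (fun t => B * Rpower t (- nu - 1)) u v); [exact Huv| | |].
  + intros t Ht; specialize (HM t ltac:(lra)); rewrite Cmod_norm in HM; exact HM.
  + apply CRInt_correct, CexRInt_continuous; intros t Ht.
    rewrite Rmin_left in Ht by exact Huv; apply Hc; lra.
  + apply (is_RInt_derive (V := R_CompleteNormedModule) (fun t => B / (- nu) * rpow t (- nu))).
    * intros t Ht; rewrite Rmin_left in Ht by exact Huv.
      replace (B * Rpower t (- nu - 1)) with (B / - nu * (- nu * Rpower t (- nu - 1)))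
        by (field; lra).
      apply (is_derive_scal (fun t => rpow t (- nu))), is_derive_rpow; lra.
    * intros t Ht; rewrite Rmin_left in Ht by exact Huv.
      apply (ex_derive_continuous (V := R_NormedModule)).
      unfold Rpower; auto_derive; lra.
- intros t; apply (continuous_mult (K := R_AbsRing) (fun _ => B / - nu));
    [apply continuous_const|apply continuous_rpow; lra].
Qed.

Lemma dtau_Psi_denominator (nu t : R) :
  0 < t -> rpow t (- nu) * (- nu + (nu - 1) * t) = t * dtau nu t.
Proof.
intros Ht; unfold dtau; rewrite rpow_pos, Rpower_minus_1 by exact Ht; field; lra.
Qed.

Lemma Psi_pullback (theta : R -> R -> R) (lo hi : R) (x : C) (nu : R) (E : C -> C) (z : C) (s : R) :
  nu < 0 -> tau_branch nu (theta nu) lo hi -> 0 < s < 1 ->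
  (RtoC (tauhat nu) * (Psi theta x nu z (s * tauhat nu) * E (z / x * RtoC (s * tauhat nu))) =
   pullback nu (theta nu) (M_fun x nu E z) s)%C.
Proof.
intros Hnu B Hs; pose proof (scaled_tau_range nu s Hnu Hs) as Hr.
pose proof (branch_theta _ _ _ _ B _ Hr) as Ht.
pose proof (branch_tauf_theta _ _ _ _ B _ Hr) as Htt.
pose proof (branch_lo _ _ _ _ B).
unfold Psi, pullback, M_fun.
set (th := theta nu (s * tauhat nu)) in *.
pose proof (branch_dtau _ _ _ _ B th Ht) as Hd.
rewrite dtau_Psi_denominator by lra.
replace (z / x * RtoC (rpow th (- nu)) * RtoC (1 - th))%C with (z / x * RtoC (s * tauhat nu))%C
  by (rewrite <- Htt, <- Cmult_assoc, <- RtoC_mult; reflexivity).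
rewrite RtoC_mult, RtoC_div by exact Hd.
field; split; intros E0; apply RtoC_inj in E0; lra.
Qed.

(** The segment contributes the factor (tauhat / x) z. Its part tauhat is the Jacobian of tau = s
    tauhat; the rest is the z / x in front of [K1] in the equation. *)
Lemma volterra_pullback (x : C) (nu : R) (E : C -> C) (z : C) (s : R) :
  nu < 0 -> x <> RtoC 0 -> z <> RtoC 0 -> 0 < s < 1 ->
  seg_fun (volterra_fun x nu E z) (RtoC 0) (RtoC (tauhat nu) / x * z)%C s =
  (z / x * (pullback nu (theta_minus nu) (M_fun x nu E z) s
            - pullback nu (theta_plus nu) (M_fun x nu E z) s))%C.
Proof.
intros Hnu Hx Hz Hs.
rewrite <- (Psi_pullback theta_minus _ _ _ _ _ _ _ Hnu (theta_minus_branch nu Hnu) Hs).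
rewrite <- (Psi_pullback theta_plus _ _ _ _ _ _ _ Hnu (theta_plus_branch nu Hnu) Hs).
unfold seg_fun, volterra_fun.
replace (0 + RtoC s * (RtoC (tauhat nu) / x * z - 0))%C
  with (z / x * RtoC (s * tauhat nu))%C by (rewrite RtoC_mult; field; exact Hx).
replace (x * (z / x * RtoC (s * tauhat nu)) / z)%C
  with (RtoC (s * tauhat nu)) by (field; split; assumption).
rewrite re_RtoC; unfold Psi_minus, Psi_plus, Cdiv; ring.
Qed.

Lemma is_RInt01_volterra (x : C) (nu : R) (E : C -> C) (z l : C) :
  nu < 0 -> x <> RtoC 0 -> z <> RtoC 0 -> H0 E -> is_RInt01 (M_fun x nu E z) l ->
  is_RInt01 (seg_fun (volterra_fun x nu E z) (RtoC 0) (RtoC (tauhat nu) / x * z)%C)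
    (z / x * l)%C.
Proof.
intros Hnu Hx Hz HE Hl.
eapply is_RInt01_ext.
{ intros s Hs; symmetry; apply volterra_pullback; assumption. }
apply is_RInt01_Cmult, is_RInt01_pullback; [exact Hnu| |exact Hl].
intros t Ht; apply continuous_M_fun; [exact Hnu| |lra].
intros u; apply differentiable_continuous_C, HE.
Qed.

(** Supplies the point z = 0, about which the Volterra equation is silent. *)
Lemma Mop_0 (x : C) (nu : R) (E : C -> C) : H0 E -> Mop x nu E (RtoC 0) = RtoC 0.
Proof.
intros [_ HE]; apply RInt01_unique.
apply is_RInt01_ext with (fun _ => RtoC 0).
- intros t _; unfold M_fun.
  replace (0 / x * RtoC (rpow t (- nu)) * RtoC (1 - t))%C with (RtoC 0)
    by (unfold Cdiv; ring).
  rewrite HE; unfold Cdiv; ring.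
- assert (Z : CRInt (fun _ => RtoC 0) 0 1 = RtoC 0) by (rewrite CRInt_const; apply Cmult_0_r).
  pose proof (is_RInt01_continuous (fun _ => RtoC 0) (fun _ => continuous_const _ _)) as I.
  rewrite Z in I; exact I.
Qed.

(* The derivative of [tauf] vanishes at [that nu]. *)
Lemma tauhat_minus_tauf_le (nu t : R) :
  nu < 0 -> that nu / 2 < t < 1 -> t <> that nu ->
  tauhat nu - tauf nu t <= 2 * (1 - nu) / that nu * (t - that nu) ^ 2.
Proof.
intros Hnu Ht Hn; pose proof (that_bounds nu Hnu) as Hth.
assert (Hc : exists c, tauhat nu - tauf nu t = dtau nu c * (that nu - t) /\
  that nu / 2 < c < 1 /\ 0 <= (that nu - c) * (that nu - t) <= (t - that nu) ^ 2).
{ unfold tauhat; destruct (Rdichotomy _ _ Hn) as [L|L].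
  - destruct (tauf_MVT nu t (that nu) ltac:(lra) L) as (c & E & Hc).
    exists c; split; [exact E|split; [lra|nra]].
  - destruct (tauf_MVT nu (that nu) t ltac:(lra) L) as (c & E & Hc).
    exists c; split; [lra|split; [lra|nra]]. }
destruct Hc as (c & -> & Hc & Hcc).
rewrite dtau_factor, Rpower_minus_1, <- rpow_pos by lra.
(* The restriction t > that / 2 keeps the mean value point [c] away from 0, where this factor may
   blow up. *)
assert (Hr : 0 <= rpow c (- nu) / c <= 2 / that nu).
{ split; [apply Rdiv_le_0_compat; [apply rpow_ge_0|lra]|].
  assert (rpow c (- nu) <= 1) by (apply rpow_le_1; lra).
  apply Rle_trans with (1 / c).
  - apply Rmult_le_compat_r; [apply Rlt_le, Rinv_0_lt_compat; lra|assumption].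
  - replace (2 / that nu) with (1 / (that nu / 2)) by (field; lra).
    apply Rmult_le_compat_l; [lra|apply Rinv_le_contravar; lra]. }
replace (rpow c (- nu) / c * ((1 - nu) * (that nu - c)) * (that nu - t))
  with ((1 - nu) * (rpow c (- nu) / c * ((that nu - c) * (that nu - t)))) by ring.
replace (2 * (1 - nu) / that nu * (t - that nu) ^ 2)
  with ((1 - nu) * (2 / that nu * (t - that nu) ^ 2)) by (field; lra).
apply Rmult_le_compat_l; [lra|]; apply Rmult_le_compat; lra.
Qed.

(** The denominator of [Psi] is a multiple of t - that, and the quadratic estimate bounds |t - that|
    below by the square root of (tauhat - tau) / L. [A] is chosen before [theta], so it serves both
    branches. *)
Lemma Psi_singular_bound (x : C) (nu : R) (z : C) :
  nu < 0 -> exists A, forall (theta : R -> R -> R) (tau : R),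
    that nu / 2 < theta nu tau < 1 -> tauf nu (theta nu tau) = tau -> tau < tauhat nu ->
    Cmod (Psi theta x nu z tau) <= A * Rpower (tauhat nu - tau) (- (1 / 2)).
Proof.
intros Hnu; pose proof (that_bounds nu Hnu) as Hth.
set (w := (z / x)%C); set (b := exp (Cmod w * (1 + Cmod (1 - x)))).
set (m := rpow (that nu / 2) (- nu)).
set (L := 2 * (1 - nu) / that nu).
assert (Hm : 0 < m) by (unfold m; rewrite rpow_pos by lra; apply exp_pos).
assert (HL : 0 < L) by (apply Rdiv_lt_0_compat; lra).
(* [b] bounds the exponential, [m] bounds t^(-nu) below for t > that / 2, 1 - nu is the slope of the
   linear factor, and [sqrt L] comes from the quadratic estimate. *)
exists (b * (/ (m * (1 - nu)) * sqrt L)); intros theta tau Ht Htau Hlt.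
unfold Psi; set (t := theta nu tau) in *; fold w; fold (exponent x nu w t).
assert (Hn : t <> that nu) by (intros E; rewrite E in Htau; unfold tauhat in Hlt; lra).
pose proof (tauhat_minus_tauf_le nu t Hnu Ht Hn) as HQ; fold L in HQ; rewrite Htau in HQ.
assert (Hmt : m <= rpow t (- nu)).
{ unfold m; rewrite !rpow_pos by lra; apply Rle_Rpower_l; lra. }
assert (Hd : 0 < Rabs (t - that nu)) by (apply Rabs_pos_lt; lra).
assert (Hs : sqrt (tauhat nu - tau) <= sqrt L * Rabs (t - that nu)).
{ rewrite <- sqrt_Rsqr_abs, <- sqrt_mult by (lra || apply Rle_0_sqr).
  apply sqrt_le_1_alt; rewrite Rsqr_pow2; exact HQ. }
assert (Hsp : 0 < sqrt (tauhat nu - tau)) by (apply sqrt_lt_R0; lra).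
replace (- nu + (nu - 1) * t) with ((nu - 1) * (t - that nu)) by (unfold that; field; lra).
assert (Hden : 0 < Rabs (rpow t (- nu) * ((nu - 1) * (t - that nu)))).
{ apply Rabs_pos_lt; repeat apply Rmult_integral_contrapositive_currified; lra. }
rewrite Cmod_div, Cmod_R.
2: { intros E; apply RtoC_inj in E; rewrite E, Rabs_R0 in Hden; lra. }
replace (Rpower (tauhat nu - tau) (- (1 / 2))) with (/ sqrt (tauhat nu - tau)).
2: { rewrite Rpower_Ropp; replace (1 / 2) with (/ 2) by lra; rewrite Rpower_sqrt by lra.
     reflexivity. }
unfold Rdiv; rewrite Rmult_assoc; apply Rmult_le_compat.
- apply Cmod_ge_0.
- apply Rlt_le, Rinv_0_lt_compat, Hden.
- apply Cmod_Cexp_le, Cmod_exponent_le; lra.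
- replace (/ (m * (1 - nu)) * sqrt L * / sqrt (tauhat nu - tau))
    with (/ (m * (1 - nu) * sqrt (tauhat nu - tau) / sqrt L)).
  2: { assert (sqrt L <> 0) by (apply Rgt_not_eq, sqrt_lt_R0, HL).
       field; repeat split; lra. }
  assert (HLp : 0 < sqrt L) by (apply sqrt_lt_R0, HL).
  apply Rinv_le_contravar.
  { apply Rdiv_lt_0_compat; [repeat apply Rmult_lt_0_compat; lra|exact HLp]. }
  rewrite !Rabs_mult, (Rabs_pos_eq (rpow t (- nu))), (Rabs_left (nu - 1))
    by (apply rpow_ge_0 || lra).
  apply Rle_trans with (m * (1 - nu) * Rabs (t - that nu)).
  + unfold Rdiv; rewrite (Rmult_assoc (m * (1 - nu))); apply Rmult_le_compat_l; [nra|].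
    apply Rmult_le_reg_r with (sqrt L); [exact HLp|].
    rewrite Rmult_assoc, Rinv_l by lra; lra.
  + replace (- (nu - 1)) with (1 - nu) by ring.
    rewrite <- Rmult_assoc; apply Rmult_le_compat_r; [lra|].
    apply Rmult_le_compat_r; lra.
Qed.

Lemma kernel_singular_bound (x : C) (nu : R) (z : C) :
  nu < 0 -> exists A : R, at_left (tauhat nu) (fun tau : R =>
    Cmod (Psi_minus x nu z tau - Psi_plus x nu z tau)%C
      <= A * Rpower (tauhat nu - tau) (- (1 / 2))).
Proof.
intros Hnu; pose proof (that_bounds nu Hnu) as Hth.
destruct (Psi_singular_bound x nu z Hnu) as [A HA].
pose proof (theta_minus_branch nu Hnu) as Bm; pose proof (theta_plus_branch nu Hnu) as Bp.
assert (H2 := branch_tauf _ _ _ _ Bm (that nu / 2) ltac:(lra)).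
exists (A + A); apply at_left_iff.
(* For tau above tauf(that / 2) the lower branch exceeds that / 2; the upper branch always does. *)
exists (tauhat nu - tauf nu (that nu / 2)); split; [lra|]; intros tau Ht.
assert (Hr : 0 < tau < tauhat nu) by lra.
pose proof (branch_theta _ _ _ _ Bm tau Hr); pose proof (branch_theta _ _ _ _ Bp tau Hr).
apply Rle_trans with (1 := Cmod_triangle _ _).
rewrite Cmod_opp, Rmult_plus_distr_r; apply Rplus_le_compat; apply HA; try lra.
- split; [apply theta_minus_gt|]; lra.
- apply (branch_tauf_theta _ _ _ _ Bm), Hr.
- apply (branch_tauf_theta _ _ _ _ Bp), Hr.
Qed.

Theorem corollary4p2 (x : C) (nu : R) (K K1 : C -> C)
    (hx : ~ (Im x = 0 /\ Re x <= 0)) (hx1 : x <> RtoC 1) (hnu : nu < 0)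
    (hK : H0 K)
    (hK1 : forall z : C,
       K1 z = ((1 - x) / (RtoC nu * (1 - RtoC nu) * x) *
               seg_int (fun zeta => K zeta / zeta) (RtoC 0) z)%C) :
  (forall z : C, ex_seg_int (fun zeta => K zeta / zeta)%C (RtoC 0) z) /\
  H0 K1 /\
  (forall E : C -> C, H0 E ->
     (forall z : C, ex_Mop x nu E z) /\
     (forall z : C, z <> RtoC 0 ->
        ex_seg_int (volterra_fun x nu E z)
          (RtoC 0) (RtoC (tauhat nu) / x * z)%C) /\
     ((forall z : C, Mop x nu E z = K1 z) <->
      (forall z : C, z <> RtoC 0 ->
         seg_int (volterra_fun x nu E z)
           (RtoC 0) (RtoC (tauhat nu) / x * z)%C = (z / x * K1 z)%C))) /\
  (forall z : C, exists A : R,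
     at_left (tauhat nu) (fun tau : R =>
       Cmod (Psi_minus x nu z tau - Psi_plus x nu z tau)%C
         <= A * Rpower (tauhat nu - tau) (- (1 / 2)))).
Proof.
assert (Hx : x <> RtoC 0).
{ intros ->; apply hx; simpl; lra. }
destruct (H0_integral_quotient K K1 _ hK hK1) as [HexK HK1].
split; [exact HexK|split; [exact HK1|split]].
2: intros z; apply kernel_singular_bound, hnu.
intros E HE.
assert (HM := fun z => ex_RInt01_M_fun x nu E z hnu HE).
assert (HV : forall z, z <> RtoC 0 ->
  is_RInt01 (seg_fun (volterra_fun x nu E z) (RtoC 0) (RtoC (tauhat nu) / x * z)%C)
    (z / x * Mop x nu E z)%C).
{ intros z Hz; apply is_RInt01_volterra; try assumption.
  destruct (HM z) as [l Hl]; unfold Mop; rewrite (RInt01_unique _ l Hl); exact Hl. }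
split; [exact HM|split].
{ intros z Hz; eexists; apply HV, Hz. }
split.
- intros H z Hz; rewrite <- H; apply RInt01_unique, HV, Hz.
(* At 0 both sides are 0; elsewhere the factor z / x is cancelled. *)
- intros H z; destruct (Ceq_dec z (RtoC 0)) as [->|Hz].
  + rewrite Mop_0 by exact HE; symmetry; apply HK1.
  + specialize (H z Hz); unfold seg_int in H; rewrite (RInt01_unique _ _ (HV z Hz)) in H.
    replace (Mop x nu E z) with (x / z * (z / x * Mop x nu E z))%C
      by (field; split; assumption).
    rewrite H; field; split; assumption.
Qed.
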